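(* Let $\Lambda$ be a uniformly discrete approximate subring in a finite-dimensional real algebra $A$. There are a finite-dimensional real algebra $A'$, a uniformly discrete co-compact subring $\Delta\subseteq A'$, and two ideals $I,J\subseteq A'$ such that: \begin{enumerate} \item $I\cap J=\{0\}$; \item there is a homomorphism $\pi\colon A'\to A$ with kernel $J$; \item $\Lambda$ is commensurable with $\pi[\Delta\cap(I+W_0)]$ for any relatively compact symmetric neighbourhood $W_0$ of $0$ in $A'$, and $J\cap\Delta=\{0\}$. \end{enumerate}
   Context: Algebras are associative, not necessarily commutative or unital; ideals are two-sided ideals of the algebra; finite-dimensional real algebras carry their usual topology. A subset $X$ of a ring is an approximate subring if it is additively symmetric ($0\in X$, $X=-X$) and $(X\cdot X)\cup(X+X)$ is covered by finitely many additive translates of $X$. $X\subseteq A$ is uniformly discrete if there is a neighbourhood $W$ of $0$ with $(x+W)\cap(y+W)=\emptyset$ for all distinct $x,y\in X$. A subring $\Delta\subseteq A'$ is co-compact if $\Delta+C=A'$ for some compact $C\subseteq A'$. Two subsets are commensurable if each is covered by finitely many additive translates of the other. A neighbourhood $W_0$ of $0$ is symmetric if $W_0=-W_0$. *)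

(* Defs.v *)
From HB Require Import structures.
From mathcomp Require Import all_boot all_order all_algebra.
From mathcomp Require Import all_classical all_reals all_analysis.

Set Implicit Arguments.
Unset Strict Implicit.
Unset Printing Implicit Defensive.

Import Order.TTheory GRing.Theory Num.Theory.
Import numFieldNormedType.Exports.

Local Open Scope classical_set_scope.
Local Open Scope ring_scope.

(* MathComp rings are unital, so the product of a possibly non-unital algebra
   is an operation [amul] of its own on a finite-dimensional vector space
   (of dimension possibly 0). *)
HB.mixin Record Vector_isRealAlgebra (R : realType) A of Vector R A := {
  amul : A -> A -> A;
  amulA : associative amul;
  amulDl : left_distributive amul +%R;
  amulDr : right_distributive amul +%R;
  amulZl : forall (c : R) (x y : A), amul (c *: x) y = c *: amul x y;
  amulZr : forall (c : R) (x y : A), amul x (c *: y) = c *: amul x y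
}.

#[short(type="fdRealAlgType")]
HB.structure Definition FdRealAlgebra (R : realType) :=
  {A of Vector R A & Vector_isRealAlgebra R A}.

(* The usual topology: that of R^n, pulled back along the coordinate
   isomorphism [v2r].  It does not depend on the choice of coordinates. *)
HB.instance Definition _ (R : realType) (A : fdRealAlgType R) :=
  Topological.copy (FdRealAlgebra.sort A)
    (initial_topology (VectorInternalTheory.v2r : A -> 'rV[R]_(dim A))).

Section Definitions.
Context {R : realType}.
Implicit Types A B : fdRealAlgType R.

Definition addset A (X Y : set A) : set A := [set x + y | x in X & y in Y].

Definition mulset A (X Y : set A) : set A := [set amul x y | x in X & y in Y].

Definition symmetric_set A (X : set A) := [set - x | x in X] = X.

Definition covered_by_translates A (X Y : set A) :=
  exists2 F : set A, finite_set F & X `<=` addset F Y.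

Definition commensurable A (X Y : set A) :=
  covered_by_translates X Y /\ covered_by_translates Y X.

Definition approximate_subring A (X : set A) :=
  [/\ X 0, symmetric_set X
    & covered_by_translates (mulset X X `|` addset X X) X].

Definition uniformly_discrete A (X : set A) :=
  exists2 W : set A, nbhs 0 W &
    forall x y, X x -> X y -> x <> y ->
      [set x + w | w in W] `&` [set y + w | w in W] = set0.

(* Subrings need not contain a unit, nor be linear subspaces. *)
Definition is_subring A (D : set A) :=
  [/\ D 0, forall x y, D x -> D y -> D (x - y)
    & forall x y, D x -> D y -> D (amul x y)].

Definition cocompact A (D : set A) :=
  exists2 C : set A, compact C & addset D C = setT.

Definition is_ideal A (I : {vspace A}) :=
  forall a x : A, x \in I -> amul a x \in I /\ amul x a \in I.

Definition is_algebra_hom A B (f : 'Hom(A, B)) :=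
  forall x y : A, f (amul x y) = amul (f x) (f y).

End Definitions.

(* Main.v *)
(* Write zspan g for the group generated by a family g, qspan for rational
   spans.  An approximate subgroup X of a real vector space stays close to a
   subspace, namely its asymptotic cone, the set of x such that X comes
   o(2^k)-close to 2^k x (Schreiber).  A walk in X steered along a basis of the
   cone shows that the cone is close to X, and also that L lies in the sum of a
   finitely generated group and a finite set.

   Choose g of minimal length with g in qspan L and L contained in
   zspan g + finite.  By minimality g is independent over Q, and a Q-linear
   functional with finitely many values on L vanishes on g.  If a product a g_i,
   with a in L, were not in qspan g, a functional phi killing g but not a g_i
   would make phi(a -) such a functional, because a L is covered by finitely
   many translates of L.  So qspan g is a Q-algebra, and multiplying g by an
   integer makes its structure constants integral.

   Then A' = zspan g (x) R, D = zspan g, pi is the linear extension of the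
   inclusion, J = ker pi, and I is the asymptotic cone of the lift X of L to D.
   For a in L, multiplication by a moves X a bounded distance from X, hence
   preserves I.  On a line of I in ker pi, nearby points of X would have bounded
   images, hence finitely many values by discreteness of L, although pi is
   injective on D. *)
Require Import Defs.
From HB Require Import structures.
From mathcomp Require Import all_boot all_order all_algebra.
From mathcomp Require Import ring lra.
From mathcomp Require Import all_classical all_reals all_analysis.

Set Implicit Arguments.
Unset Strict Implicit.
Unset Printing Implicit Defensive.

Import Order.TTheory GRing.Theory Num.Theory.
Import numFieldNormedType.Exports.
Import VectorInternalTheory.

Local Open Scope classical_set_scope.
Local Open Scope ring_scope.

(** * The coordinate norm *)

Definition vnorm (R : realType) (V : vectType R) (x : V) : R :=
  `|VectorInternalTheory.v2r x|.

Section CoordinateNorm.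
Context {R : realType}.
Implicit Types V W : vectType R.

Lemma vnorm_ge0 V (x : V) : 0 <= vnorm x.
Proof. exact: normr_ge0. Qed.

Lemma vnorm0 V : vnorm (0 : V) = 0.
Proof. by rewrite /vnorm linear0 normr0. Qed.

Lemma vnormN V (x : V) : vnorm (- x) = vnorm x.
Proof. by rewrite /vnorm linearN normrN. Qed.

Lemma vnormZ V (c : R) (x : V) : vnorm (c *: x) = `|c| * vnorm x.
Proof. by rewrite /vnorm linearZ /= normrZ. Qed.

Lemma ler_vnormD V (x y : V) : vnorm (x + y) <= vnorm x + vnorm y.
Proof. by rewrite /vnorm linearD ler_normD. Qed.

Lemma ler_vnormB V (x y : V) : vnorm (x - y) <= vnorm x + vnorm y.
Proof. by rewrite -(vnormN y) ler_vnormD. Qed.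

Lemma vnormBC V (x y : V) : vnorm (x - y) = vnorm (y - x).
Proof. by rewrite -vnormN opprB. Qed.

Lemma vnorm_triangle V (y x z : V) :
  vnorm (x - z) <= vnorm (x - y) + vnorm (y - z).
Proof. by rewrite -[x - z](subrKA y) ler_vnormD. Qed.

Lemma vnorm_eq0 V (x : V) : (vnorm x == 0) = (x == 0).
Proof. by rewrite /vnorm normr_eq0 -[in RHS](inj_eq (can_inj v2rK)) linear0. Qed.

Lemma ler_vnorm_sum V (I : finType) (F : I -> V) :
  vnorm (\sum_i F i) <= \sum_i vnorm (F i).
Proof.
apply: (big_ind2 (fun x a => vnorm x <= a)) => [|x a y b xa yb|i _]//.
  by rewrite vnorm0.
by apply: le_trans (ler_vnormD _ _) _; exact: lerD.
Qed.

Lemma vnorm_coord_le V (x : V) i : `|v2r x 0 i| <= vnorm x.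
Proof.
rewrite /vnorm /Num.norm/= mx_normrE.
by apply: (le_bigmax _ _ (0, i)).
Qed.

Lemma vnorm_le V (x : V) (r : R) :
  0 <= r -> (forall i, `|v2r x 0 i| <= r) -> vnorm x <= r.
Proof.
move=> r0 xr; rewrite /vnorm /Num.norm/= mx_normrE.
by apply/bigmax_le => // -[i j] _ /=; rewrite ord1.
Qed.

Lemma seminorm_vnorm V (p : V -> R) :
  (forall x y, p (x + y) <= p x + p y) ->
  (forall c x, p (c *: x) = `|c| * p x) ->
  exists2 k, 0 <= k & forall x, p x <= k * vnorm x.
Proof.
move=> pD pZ; have p0 : p 0 = 0 by rewrite -(scale0r 0) pZ normr0 mul0r.
have p_ge0 x : 0 <= p x.
  have := pD x (- x); rewrite subrr p0 -scaleN1r pZ normrN1 mul1r.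
  by move=> ?; lra.
pose b i : V := r2v (delta_mx 0 i).
exists (\sum_i p (b i)) => [|x]; first by apply: sumr_ge0.
have sub (I : finType) (F : I -> V) : p (\sum_i F i) <= \sum_i p (F i).
  apply: (big_ind2 (fun u a => p u <= a)) => [|u a v c ua vc|i _]//.
    by rewrite p0.
  by apply: le_trans (pD _ _) _; exact: lerD.
have {1}-> : x = \sum_i v2r x 0 i *: b i.
  rewrite -{1}(v2rK x) [in LHS](row_sum_delta (v2r x)) linear_sum.
  by apply: eq_bigr => i _; rewrite linearZ.
apply: le_trans (sub _ _) _; rewrite mulr_suml; apply: ler_sum => i _.
by rewrite pZ mulrC; apply: ler_wpM2l => //; exact: vnorm_coord_le.
Qed.

Lemma linear_vnorm V W (f : {linear V -> W}) :
  exists2 k, 0 <= k & forall x, vnorm (f x) <= k * vnorm x.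
Proof.
apply: seminorm_vnorm => [x y|c x]; first by rewrite linearD ler_vnormD.
by rewrite linearZ vnormZ.
Qed.

(** A finite form of the compactness of balls: the ball is cut into boxes of side [e / 2], and
    [cell] names the box of a point. *)
Lemma vnorm_cells V (r e : R) : 0 < e ->
  exists (T : finType) (cell : V -> T), forall x y,
    vnorm x <= r -> vnorm y <= r -> cell x = cell y -> vnorm (x - y) < e.
Proof.
move=> e0; pose h := e / 2; have h0 : 0 < h by rewrite /h; lra.
pose M := Num.truncn (2 * r / h).
pose cell (x : V) := [ffun i => inord (Num.truncn ((v2r x 0 i + r) / h)) : 'I_M.+1].
exists {ffun 'I_(dim V) -> 'I_M.+1}, cell => x y xr yr exy.
have bnd (z : V) i : vnorm z <= r -> 0 <= (v2r z 0 i + r) / h <= 2 * r / h.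
  move=> zr; have := le_trans (vnorm_coord_le z i) zr; rewrite ler_norml.
  move=> /andP[lo hi]; apply/andP; split.
    by apply: divr_ge0; [lra | exact: ltW].
  by rewrite ler_pM2r ?invr_gt0//; lra.
apply: (@le_lt_trans _ _ h); last by rewrite /h; lra.
apply: vnorm_le => [|i]; first exact: ltW.
have : cell x i = cell y i by rewrite exy.
have mono z : vnorm z <= r -> (Num.truncn ((v2r z 0%R i + r) / h) < M.+1)%N.
  by move=> /(bnd _ i)/andP[_ zM]; rewrite ltnS; exact: le_truncn.
move=> /(congr1 (@nat_of_ord _)); rewrite !ffunE !inordK ?mono// => exy'.
have /andP[x0 _] := bnd _ i xr; have /andP[y0 _] := bnd _ i yr.
have /andP[xlo xhi] := truncn_itv x0; have /andP[ylo yhi] := truncn_itv y0.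
rewrite linearB !mxE ler_norml.
move: xlo xhi ylo yhi; rewrite exy' -[_.+1%:R]natr1.
set t := (Num.truncn _)%:R => xlo xhi ylo yhi.
have ->: v2r x 0 i = (v2r x 0 i + r) / h * h - r by field; lra.
have ->: v2r y 0 i = (v2r y 0 i + r) / h * h - r by field; lra.
move: xlo xhi ylo yhi; set u := _ / h; set v := _ / h => xlo xhi ylo yhi.
by apply/andP; split; nra.
Qed.

Lemma separated_finite V (S : set V) (r e : R) : 0 < e ->
  (forall x, S x -> vnorm x <= r) ->
  (forall x y, S x -> S y -> vnorm (x - y) < e -> x = y) -> finite_set S.
Proof.
move=> e0 Sr Se; have [T [cell cellP]] := vnorm_cells V r e0.
have inj : {in S &, injective cell}.
  move=> x y /set_mem Sx /set_mem Sy xy.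
  by apply: Se => //; apply: cellP => //; exact: Sr.
have : finite_set (cell @` S) by exact: finite_finset.
by rewrite (eq_finite_set (inj_card_eq inj)).
Qed.

(** The intervals with centre [u k / 2 ^+ k] and radius [C / 2 ^+ k] are nested, and the supremum
    [l] of their left ends lies in all of them. *)
Lemma dyadic_limit_real (u : nat -> R) (C : R) :
  (forall k, `|2 * u k - u k.+1| <= C) ->
  exists l, forall k, `|2 ^+ k * l - u k| <= C.
Proof.
move=> uC; have C0 : 0 <= C by apply: le_trans (uC 0%N).
pose a k := (u k - C) / 2 ^+ k; pose b k := (u k + C) / 2 ^+ k.
have p2 k : 0 < (2 : R) ^+ k by rewrite exprn_gt0.
have aS k : a k <= a k.+1.
  rewrite /a exprS ler_pdivrMr// invfM [_ * (_^-1 / _)]mulrA mulfVK ?gt_eqF//.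
  by have := uC k; rewrite ler_norml; lra.
have bS k : b k.+1 <= b k.
  rewrite /b exprS ler_pdivlMr// invfM [_ * (_^-1 / _)]mulrA mulfVK ?gt_eqF//.
  by have := uC k; rewrite ler_norml; lra.
have ab k : a k <= b k by rewrite ler_pM2r ?invr_gt0//; lra.
have am : {homo a : m n / (m <= n)%N >-> m <= n} by exact/nondecreasing_seqP.
have bm : {homo b : m n / (m <= n)%N >-> n <= m} by exact/nonincreasing_seqP.
have abmn m n : a m <= b n.
  have [mn|nm] := leqP m n; first exact: le_trans (am _ _ mn) (ab n).
  exact: le_trans (ab m) (bm _ _ (ltnW nm)).
exists (sup (range a)) => k.
have lo : a k <= sup (range a).
  by apply: ub_le_sup; [exists (b 0) => _ [m _ <-] | exists k].
have hi : sup (range a) <= b k.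
  by apply: ge_sup; [exists (a 0), 0%N | move=> _ [m _ <-]].
move: lo hi; rewrite ler_pdivrMr// ler_pdivlMr// mulrC => lo hi.
by rewrite ler_norml; lra.
Qed.

Lemma dyadic_limit V (z : nat -> V) (C : R) :
  (forall k, vnorm (2 *: z k - z k.+1) <= C) ->
  exists x, forall k, vnorm (2 ^+ k *: x - z k) <= C.
Proof.
move=> zC; have C0 : 0 <= C by apply: le_trans (vnorm_ge0 _) (zC 0%N).
have /choice[l lP] i : exists l, forall k, `|2 ^+ k * l - v2r (z k) 0 i| <= C.
  apply: dyadic_limit_real => k; apply: le_trans (zC k).
  by apply: le_trans (vnorm_coord_le _ i); rewrite linearB linearZ !mxE.
exists (r2v (\row_i l i)) => k; apply: vnorm_le => // i.
by rewrite linearB linearZ/= r2vK !mxE.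
Qed.

End CoordinateNorm.

(** * The coordinate norm and the usual topology *)

Section CoordinateTopology.
Context {R : realType} (A : fdRealAlgType R).

Let v2r_continuous : continuous (v2r : A -> 'rV[R]_(dim A)).
Proof. exact: initial_continuous. Qed.

Let r2v_continuous : continuous (r2v : 'rV[R]_(dim A) -> A).
Proof.
apply: (@continuous_comp_initial A _ _ v2r) => x /=.
have -> : v2r \o r2v = id :> ('rV[R]_(dim A) -> 'rV[R]_(dim A)).
  by apply/funext => y /=; rewrite r2vK.
exact: cvg_id.
Qed.

Lemma nbhs0_vnorm (W : set A) :
  nbhs 0 W -> exists2 e : R, 0 < e & forall x : A, vnorm x < e -> W x.
Proof.
move=> W0; have : nbhs (0 : 'rV[R]_(dim A)) (r2v @^-1` W).
  by apply: r2v_continuous; rewrite linear0.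
move=> /nbhs_ballP[e /= e0 eW]; exists e => // x xe.
rewrite -(v2rK x); apply: eW.
by rewrite -ball_normE /= sub0r normrN.
Qed.

Lemma vnorm_ball_nbhs0 (e : R) : 0 < e -> nbhs (0 : A) [set x | vnorm x < e].
Proof.
move=> e0; rewrite (_ : [set _ | _] = v2r @^-1` ball (0 : 'rV[R]_(dim A)) e).
  apply: v2r_continuous; rewrite linear0; exact: nbhsx_ballx.
by apply/seteqP; split => x; rewrite -ball_normE /= sub0r normrN.
Qed.

Lemma compact_vnorm_ball (r : R) : compact [set x : A | vnorm x <= r].
Proof.
have -> : [set x : A | vnorm x <= r] =
    r2v @` [set y : 'rV[R]_(dim A) | `|y| <= r].
  apply/seteqP; split => [x xr|_ [y yr <-]]; last by rewrite /vnorm /= r2vK.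
  by exists (v2r x) => //; rewrite v2rK.
apply: continuous_compact; first exact: continuous_subspaceT.
apply: bounded_closed_compact.
  by exists r; split; [exact: num_real|move=> s rs y /= /le_trans; apply; exact: ltW].
apply: (closed_comp (f := fun y : 'rV[R]_(dim A) => `|y|) (D := [set x | x <= r])).
  by move=> x _; exact: norm_continuous.
exact: closed_le.
Qed.

Lemma precompact_vnorm (W : set A) :
  precompact W -> exists r, forall x, W x -> vnorm x <= r.
Proof.
rewrite precompactE => cW.
have : compact (v2r @` closure W).
  by apply: continuous_compact => //; exact: continuous_subspaceT.
move=> /compact_bounded[M [_ MW]]; exists (M + 1) => x Wx.
by apply: (MW (M + 1)); [lra | exists x => //; exact: subset_closure].
Qed.

End CoordinateTopology.

Section VectorSubspaces.
Context {K : fieldType}.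

(** Among the subspaces contained in [S] take one of largest dimension: adding to it the line of a
    point of [S] stays in [S], hence cannot enlarge it. *)
Lemma vspace_of_set (V : vectType K) (S : set V) :
  S 0 -> (forall x y, S x -> S y -> S (x + y)) ->
  (forall c x, S x -> S (c *: x)) ->
  exists U : {vspace V}, forall x, x \in U <-> S x.
Proof.
move=> S0 SD SZ.
pose P n := `[< exists2 U : {vspace V}, \dim U = n & [set` U] `<=` S >].
have P0 : exists n, P n.
  exists 0%N; apply/asboolP; exists 0%VS; first exact: dimv0.
  by move=> x /=; rewrite memv0 => /eqP ->.
have Ple n : P n -> (n <= \dim {:V})%N.
  by move=> /asboolP[U <- _]; exact/dimvS/subvf.
case: (ex_maxnP P0 Ple) => n /asboolP[U Un US] max.
exists U => x; split=> [xU|Sx]; first exact: US.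
have : P (\dim (U + <[x]>)%VS).
  apply/asboolP; exists (U + <[x]>)%VS => // y /memv_addP[u uU [w]].
  by move=> /vlineP[k ->] ->; apply: SD; [exact: US|exact: SZ].
move=> /max; rewrite -Un => dimle.
have : (U == U + <[x]>)%VS by rewrite eqEdim addvSl.
by move=> /eqP ->; apply: (subvP (addvSr _ _)); exact: memv_line.
Qed.

End VectorSubspaces.

(** * Approximate subgroups of real vector spaces *)

(** These rules feed [vring], which proves an identity between vectors in coordinates, where [ring]
    applies. *)
Lemma v2r_lin (R : realType) (V : vectType R) :
  ((forall x y : V, v2r (x + y) = v2r x + v2r y)%R *
   (forall x : V, v2r (- x) = - v2r x)%R *
   (forall (c : R) (x : V), v2r (c *: x) = c *: v2r x)%R *
   (v2r (0 : V) = 0)%R)%type.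
Proof.
do ![split]; [exact: linearD|exact: linearN| |exact: linear0].
by move=> c x; rewrite linearZ.
Qed.

Ltac vring := apply: (can_inj v2rK); apply/rowP => ?; rewrite !v2r_lin !mxE; ring.

Lemma exp2_dominates (R : realType) (e M : R) : 0 < e ->
  exists K, forall k, (K <= k)%N -> M <= e * 2 ^+ k.
Proof.
move=> e0; exists (Num.truncn (M / e)).+1 => k Kk.
rewrite mulrC -ler_pdivrMr//; apply: le_trans (ltW (truncnS_gt _)) _.
rewrite -natrX ler_nat; apply: leq_trans Kk _.
by rewrite ltnW// ltn_expl.
Qed.

Section ApproximateSubgroups.
Context {R : realType} {V : vectType R} (X : set V) (C : R) (x0 : V).
Hypothesis Xx0 : X x0.
Hypothesis XB : forall x y, X x -> X y ->
  exists2 z, X z & vnorm (x - y - z) <= C.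

Let near0 : exists2 z, X z & vnorm z <= C.
Proof.
by have [z Xz] := XB Xx0 Xx0; rewrite subrr sub0r vnormN; exists z.
Qed.

Let XD x y : X x -> X y -> exists2 z, X z & vnorm (x + y - z) <= 3 * C.
Proof.
(* A point [y0] of [X] near 0 turns the sum into the difference of [x] and [y0 - y], at the cost of
   three errors [C]. *)
move=> Xx Xy; have [y0 Xy0 y0C] := near0.
have [w Xw wC] := XB Xy0 Xy; have [z Xz zC] := XB Xx Xw; exists z => //.
have -> : x + y - z = (x - w - z) - (y0 - y - w) + y0 by vring.
apply: le_trans (ler_vnormD _ _) _.
have := ler_vnormB (x - w - z) (y0 - y - w); lra.
Qed.

(** Powers of 2 fit the repeated doubling in [asymptotic_cone_dense]; an error of o(2^k), instead of
    a bounded one, makes it easy to see that the cone is closed. *)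
Definition asymptotic_cone : set V := [set x | forall e : R, 0 < e ->
  exists K, forall k, (K <= k)%N ->
    exists2 z, X z & vnorm (2 ^+ k *: x - z) <= e * 2 ^+ k].

Lemma asymptotic_cone_near r x :
  (forall k, exists2 z, X z & vnorm (2 ^+ k *: x - z) <= r) ->
  asymptotic_cone x.
Proof.
move=> xr e e0; have [K Kr] := exp2_dominates r e0.
exists K => k /Kr rk; have [z Xz zr] := xr k.
by exists z => //; exact: le_trans rk.
Qed.

Lemma asymptotic_cone0 : asymptotic_cone 0.
Proof.
have [y0 Xy0 y0C] := near0; apply: (@asymptotic_cone_near C) => k; exists y0 => //.
by rewrite scaler0 sub0r vnormN.
Qed.

Lemma asymptotic_coneB x y :
  asymptotic_cone x -> asymptotic_cone y -> asymptotic_cone (x - y).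
Proof.
move=> Tx Ty e e0; have e4 : 0 < e / 4 by lra.
have [K1 xK] := Tx _ e4; have [K2 yK] := Ty _ e4.
have [K3 CK] := exp2_dominates C e4.
exists (maxn K1 (maxn K2 K3)) => k; rewrite !geq_max => /and3P[k1 k2 k3].
have [u Xu ux] := xK _ k1; have [w Xw wy] := yK _ k2.
have [z Xz zuw] := XB Xu Xw; exists z => //.
have -> : 2 ^+ k *: (x - y) - z =
    (2 ^+ k *: x - u) - (2 ^+ k *: y - w) + (u - w - z) by vring.
apply: le_trans (ler_vnormD _ _) _.
have := ler_vnormB (2 ^+ k *: x - u) (2 ^+ k *: y - w).
have : 0 < e * 2 ^+ k by rewrite mulr_gt0// exprn_gt0.
have := CK _ k3; lra.
Qed.

Lemma asymptotic_coneN x : asymptotic_cone x -> asymptotic_cone (- x).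
Proof. by rewrite -sub0r; apply: asymptotic_coneB; exact: asymptotic_cone0. Qed.

Lemma asymptotic_coneD x y :
  asymptotic_cone x -> asymptotic_cone y -> asymptotic_cone (x + y).
Proof.
by move=> Tx /asymptotic_coneN Ty; rewrite -[y]opprK; exact: asymptotic_coneB.
Qed.

Lemma asymptotic_cone_half x : asymptotic_cone x -> asymptotic_cone (2^-1 *: x).
Proof.
move=> Tx e e0; have [K xK] := Tx _ e0; exists K.+1 => -[//|k] Kk.
have [z Xz zx] := xK _ Kk; exists z => //.
have -> : 2 ^+ k.+1 *: (2^-1 *: x) = 2 ^+ k *: x.
  by rewrite scalerA exprS; congr (_ *: _); field.
apply: le_trans zx _; rewrite ler_pM2l// exprS.
have : 0 < (2 : R) ^+ k by rewrite exprn_gt0.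
lra.
Qed.

Lemma asymptotic_cone_dyadic j n x :
  asymptotic_cone x -> asymptotic_cone ((n%:R / 2 ^+ j) *: x).
Proof.
move=> Tx; elim: j => [|j IH].
  rewrite divr1; elim: n => [|n IH]; first by rewrite scale0r; exact: asymptotic_cone0.
  by rewrite -natr1 scalerDl scale1r; exact: asymptotic_coneD.
have -> : n%:R / 2 ^+ j.+1 = 2^-1 * (n%:R / 2 ^+ j) :> R.
  by rewrite exprS invfM; ring.
by rewrite -scalerA; exact: asymptotic_cone_half.
Qed.

Lemma asymptotic_cone_closed x :
  (forall d : R, 0 < d -> exists2 y, asymptotic_cone y & vnorm (x - y) <= d) ->
  asymptotic_cone x.
Proof.
move=> Tx e e0; have e2 : 0 < e / 2 by lra.
have [y Ty xy] := Tx _ e2; have [K yK] := Ty _ e2.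
exists K => k /yK[z Xz zy]; exists z => //.
have -> : 2 ^+ k *: x - z = 2 ^+ k *: (x - y) + (2 ^+ k *: y - z) by vring.
apply: le_trans (ler_vnormD _ _) _; rewrite vnormZ ger0_norm ?exprn_ge0//.
have : 0 < (2 : R) ^+ k by rewrite exprn_gt0.
by move: zy; set t := 2 ^+ k => *; nra.
Qed.

(** Sums and halving give the dyadic multiples, and closedness gives the nonnegative real ones as
    limits. *)
Lemma asymptotic_coneZ c x : asymptotic_cone x -> asymptotic_cone (c *: x).
Proof.
move=> Tx; wlog c0 : c / 0 <= c => [H|].
  have [/H//|c0] := leP 0 c.
  by rewrite -[c]opprK scaleNr; apply/asymptotic_coneN/H; lra.
apply: asymptotic_cone_closed => d d0.
have [j] := exp2_dominates (vnorm x) d0 => /(_ j (leqnn j)) xj.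
have p2 : 0 < (2 : R) ^+ j by rewrite exprn_gt0.
exists (((Num.truncn (c * 2 ^+ j))%:R / 2 ^+ j) *: x).
  exact: asymptotic_cone_dyadic.
rewrite -scalerBl vnormZ.
have cj : 0 <= c * 2 ^+ j by rewrite mulr_ge0// ltW.
have /andP[] := truncn_itv cj; rewrite -natr1; set n := _%:R => lo hi.
have -> : c - n / 2 ^+ j = (c * 2 ^+ j - n) / 2 ^+ j by field; rewrite gt_eqF.
rewrite ger0_norm; last by apply: divr_ge0; [lra|exact: ltW].
rewrite mulrAC ler_pdivrMr//.
have := vnorm_ge0 x; nra.
Qed.

(** Doubling [x] repeatedly inside [X], with an error of [3 * C] each time, gives a sequence that
    [dyadic_limit] compares with the multiples [2 ^+ k *: y]; its term at [k = 0] is [x]. *)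
Lemma asymptotic_cone_dense x : X x ->
  exists2 y, asymptotic_cone y & vnorm (x - y) <= 3 * C.
Proof.
move=> Xx.
have /choice[f fP] (z : V) : exists w, X z -> X w /\ vnorm (2 *: z - w) <= 3 * C.
  have [Xz|nXz] := pselect (X z); last by exists 0.
  have [w Xw wz] := XD Xz Xz; exists w => _; split => //.
  by rewrite (_ : 2 *: z = z + z)//; vring.
pose z k := iter k f x.
have Xz k : X (z k) by elim: k => //= k /fP[].
have [y yz] : exists y, forall k, vnorm (2 ^+ k *: y - z k) <= 3 * C.
  by apply: dyadic_limit => k; have [] := fP _ (Xz k).
exists y; last by have := yz 0%N; rewrite scale1r vnormBC.
by apply: (@asymptotic_cone_near (3 * C)) => k; exists (z k).
Qed.

(* The walk [a -> a - l] (corrected into [Y]) steered by the approximate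
   multiples [l] of a basis of [U] reaches every point of [U] up to [D]; the
   freedom in [Y] also shows that few elements of [X] generate the others. *)
Lemma schreiber :
  exists (U : {vspace V}) (r D : R) (s : seq V),
  [/\ forall x, X x -> exists2 u, u \in U & vnorm (x - u) <= r,
      forall l, l \in s -> X l
    & forall (Y : set V) (a0 : V), Y a0 -> Y `<=` X ->
      (forall a l, Y a -> l \in s -> exists2 b, Y b & vnorm (a - l - b) <= C) ->
      forall v, v \in U -> exists2 a, Y a & vnorm (v - a) <= D].
Proof.
have [U UP] := vspace_of_set asymptotic_cone0 asymptotic_coneD asymptotic_coneZ.
pose d := \dim U; pose b (i : 'I_d) := (vbasis U)`_i.
(* The distance still to walk is measured by [p], the l1 norm of the coordinates in a basis of the
   cone. *)
pose p w : R := \sum_(i < d) `|coord (vbasis U) i w|.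
have [K K0 pK] : exists2 K, 0 <= K & forall w, p w <= K * vnorm w.
  apply: seminorm_vnorm => [x y|c x].
    by rewrite -big_split; apply: ler_sum => i _; rewrite linearD ler_normD.
  by rewrite mulr_sumr; apply: eq_bigr => i _; rewrite linearZ normrM.
have Tb (i : 'I_d) : b i \in U by apply/vbasis_mem/mem_nth; rewrite size_tuple.
(* The constants make a step of the walk, of length [t = 2 ^+ k] along a basis vector, err by at
   most [t / 2] in [p]: one half of this comes from approximating the basis vector, the other from
   seven errors [C], whence 28 = 4 * 7. *)
have e0 : 0 < (4 * (K + 1))^-1 by rewrite invr_gt0; lra.
have [K1 K1P] := exp2_dominates (28 * C * K) (ltr01 : 0 < 1 :> R).
have /choice[Kp KpP] (i : 'I_d) := (UP (b i)).1 (Tb i) _ e0.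
have /choice[Km KmP] (i : 'I_d) := asymptotic_coneN ((UP (b i)).1 (Tb i)) e0.
pose k := (K1 + (\sum_i Kp i + \sum_i Km i))%N.
have kp i : (Kp i <= k)%N.
  by rewrite /k (bigD1 i)//= !addnA (addnC K1) -!addnA leq_addr.
have km i : (Km i <= k)%N.
  by rewrite /k [X in (_ + (_ + X))%N](bigD1 i)//= addnCA addnA addnCA leq_addr.
have lpE (i : 'I_d) : exists z, X z /\
    vnorm (2 ^+ k *: b i - z) <= (4 * (K + 1))^-1 * 2 ^+ k.
  by have [z] := KpP i k (kp i); exists z.
have lmE (i : 'I_d) : exists z, X z /\
    vnorm (2 ^+ k *: - b i - z) <= (4 * (K + 1))^-1 * 2 ^+ k.
  by have [z] := KmP i k (km i); exists z.
have [lp lpP] := choice lpE; have [lm lmP] := choice lmE.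
have {K1P} : 28 * C * K <= 2 ^+ k.
  by rewrite -[leRHS]mul1r; apply: K1P; rewrite /k leq_addr.
have : 0 < (2 : R) ^+ k by rewrite exprn_gt0.
move: lpP lmP; clear lpE lmE; move: (2 ^+ k) => t lpP lmP t0 tC.
(* The walk stops once all coordinates of [v - u] are at most [t]; the term [3 * C] is for passing
   from [u] to the point of [Y]. *)
pose D := t * \sum_(i < d) vnorm (b i) + 3 * C.
exists U, (3 * C), D, (codom lp ++ codom lm).
split=> [x /asymptotic_cone_dense[y /UP yU xy]|l|].
- by exists y.
- rewrite mem_cat => /orP[] /codomP[i ->]; first by have [] := lpP i.
  by have [] := lmP i.
move=> Y a0 Ya0 YX Ystep v vU.
have near a : Y a -> exists2 u, u \in U & vnorm (a - u) <= 3 * C.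
  by move=> /YX/asymptotic_cone_dense[u /UP uU au]; exists u.
have close a u : u \in U -> vnorm (a - u) <= 3 * C ->
    (forall i : 'I_d, `|coord (vbasis U) i (v - u)| <= t) -> vnorm (v - a) <= D.
  move=> uU au allt; rewrite /D vnormBC; apply: le_trans (vnorm_triangle u a v) _.
  rewrite addrC; apply: lerD => //; rewrite vnormBC.
  rewrite [X in vnorm X](coord_vbasis (memvB vU uU)).
  apply: le_trans (ler_vnorm_sum _) _; rewrite mulr_sumr; apply: ler_sum => i _.
  by rewrite vnormZ; apply: ler_wpM2r => //; exact: vnorm_ge0.
(* [u] is a point of [U] that shadows [a], and [n] bounds the number of steps left, as each step
   lowers [p] by at least [t / 2]. *)
suff walk n a u : Y a -> u \in U -> vnorm (a - u) <= 3 * C ->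
    p (v - u) <= n%:R * (t / 2) -> exists2 a, Y a & vnorm (v - a) <= D.
  have [u0 u0U au0] := near _ Ya0.
  apply: (walk (Num.truncn (p (v - u0) / (t / 2))).+1 a0 u0) => //.
  by rewrite -ler_pdivrMr; [apply/ltW/truncnS_gt|lra].
have coordE (i j : 'I_d) : coord (vbasis U) j (b i) = (i == j)%:R.
  by rewrite /b coord_free//; exact/(basis_free (vbasisP U)).
have pB x y : p (x - y) <= p x + p y.
  by rewrite -big_split; apply: ler_sum => i _; rewrite linearB ler_normB.
have Ke : K * (4 * (K + 1))^-1 <= 4^-1.
  by rewrite ler_pdivrMr; lra.
move: ((4 * (K + 1))^-1) lpP lmP {e0} Ke => e lpP lmP Ke.
elim: n a u => [|n IH] a u Ya uU au pn;
  (have [allt|] := pselect (forall i : 'I_d, `|coord (vbasis U) i (v - u)| <= t);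
    first by exists a => //; exact: close uU au allt).
all: move=> /existsNP[i /negP]; rewrite -ltNge => ti.
  have : `|coord (vbasis U) i (v - u)| <= p (v - u).
    by rewrite /p (bigD1 i)//= lerDl sumr_ge0.
  by lra.
(* A step subtracts [l], so a positive coordinate calls for [l] near [- t *: b i], and a negative
   one for [l] near [t *: b i]. *)
have [l [sg [ls sgt lsg]]] : exists l (sg : R),
  [/\ l \in codom lp ++ codom lm,
      `|coord (vbasis U) i (v - u) - sg * t| =
      `|coord (vbasis U) i (v - u)| - t
    & vnorm (- (sg * t) *: b i - l) <= e * t].
  move: ti; have [cpos ti|cneg ti] := ger0P (coord (vbasis U) i (v - u)).
    exists (lm i), 1; rewrite mem_cat codom_f orbT mul1r scaleNr -scalerN.
    by split=> //; [rewrite ger0_norm; lra|have [] := lmP i].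
  exists (lp i), (-1); rewrite mem_cat codom_f mulN1r opprK; split => //.
    by rewrite ltr0_norm; lra.
  by have [] := lpP i.
have [a' Ya' a'C] := Ystep _ _ Ya ls.
have [u' u'U au'] := near _ Ya'.
rewrite -natr1 in pn; apply: (IH _ _ Ya' u'U au').
pose e' := u' - u - (sg * t) *: b i.
have e'E : e' = (a - u) - (a - l - a') + (- (sg * t) *: b i - l) - (a' - u').
  by rewrite /e'; vring.
have e'le : vnorm e' <= 7 * C + e * t.
  rewrite e'E.
  have := ler_vnormB ((a - u) - (a - l - a') + (- (sg * t) *: b i - l)) (a' - u').
  have := ler_vnormD ((a - u) - (a - l - a')) (- (sg * t) *: b i - l).
  have := ler_vnormB (a - u) (a - l - a').
  lra.
have pe' : p e' <= t / 2.
  apply: le_trans (pK _) _; have := ler_wpM2l K0 e'le.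
  have := ler_wpM2r (ltW t0) Ke => Ket.
  have -> : K * (7 * C + e * t) = (28 * C * K) / 4 + K * e * t by field.
  lra.
have -> : v - u' = (v - u - (sg * t) *: b i) - e' by rewrite /e'; vring.
apply: le_trans (pB _ _) _.
(* Without the error [e'], the step changes only coordinate [i], and brings it closer to 0 by
   [t]. *)
suff : p (v - u - (sg * t) *: b i) <= p (v - u) - t by lra.
have coordB (j : 'I_d) : coord (vbasis U) j (v - u - (sg * t) *: b i) =
    coord (vbasis U) j (v - u) - sg * t * (i == j)%:R.
  by rewrite linearB linearZ /= coordE.
rewrite /p (bigD1 i)//= [in leRHS](bigD1 i)//= coordB eqxx mulr1.
rewrite sgt addrAC lerD2r lerD2l; apply: ler_sum => j ji.
by rewrite coordB eq_sym (negbTE ji) mulr0 subr0.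
Qed.

End ApproximateSubgroups.

(** * Rational and integer spans *)

Section RationalSpans.
Context {R : realType} {V : vectType R}.
Implicit Types (S Z : set V) (x y : V).

(** [V] is declared over the reals only, so rational scalars enter through [ratr]; the inductive
    form allows properties of [L] to be extended to its span by induction. *)
Inductive qspan S : V -> Prop :=
| qspan0 : qspan S 0
| qspan_mem x : S x -> qspan S x
| qspanD x y : qspan S x -> qspan S y -> qspan S (x + y)
| qspanZ (q : rat) x : qspan S x -> qspan S (ratr q *: x).

Definition qlinear (phi : V -> rat) :=
  (forall x y, phi (x + y) = phi x + phi y) /\
  (forall q x, phi (ratr q *: x) = q * phi x).

Section QLinear.
Variables (phi : V -> rat) (phiQ : qlinear phi).

Lemma qlinear0 : phi 0 = 0.
Proof. by rewrite -(scale0r 0) -(rmorph0 ratr) phiQ.2 mul0r. Qed.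

Lemma qlinearN x : phi (- x) = - phi x.
Proof.
have -> : - x = ratr (-1) *: x by rewrite rmorphN1 scaleN1r.
by rewrite phiQ.2 mulN1r.
Qed.

Lemma qlinear_sum (I : finType) (F : I -> V) :
  phi (\sum_i F i) = \sum_i phi (F i).
Proof.
apply: (big_ind2 (fun x q => phi x = q)) => [|x q y r <- <-|//].
  exact: qlinear0.
exact: phiQ.1.
Qed.

Lemma qlinear_int (n : int) x : phi (n%:~R *: x) = n%:~R * phi x.
Proof. by rewrite -(ratr_int R n) phiQ.2. Qed.

End QLinear.

Let qclosed Z := [/\ Z 0, forall x y, Z x -> Z y -> Z (x + y)
  & forall q x, Z x -> Z (ratr q *: x)].

(** Zorn's lemma gives a rational subspace [Z] maximal among those that contain [S] and miss [b]. If
    [x] is outside [Z], then [Z] with [x] adjoined contains [b], and this relation is solved for [x]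
    modulo [Z]. *)
Let qspan_maximal S b : ~ qspan S b ->
  exists2 Z, [/\ qclosed Z, qspan S `<=` Z & ~ Z b]
    & forall x, exists q, Z (x - ratr q *: b).
Proof.
(* Taking the union with [qspan S] takes care of the empty chain, whose union still satisfies
   [P]. *)
move=> Sb; pose P Y := qclosed (Y `|` qspan S) /\ ~ (Y `|` qspan S) b.
have [F FP Ftot|Y [[[Y0 YD YZ] Yb] Ymax]] := @Zorn_bigcup V P.
  split; last first.
    by move=> [[Y FY Yb]|Sb']; [apply: (FP _ FY).2; left|exact: Sb].
  split; first by right; exact: qspan0.
    move=> x y [[X FX Xx]|Sx] [[Y FY Yy]|Sy].
    - have [XY|YX] := Ftot _ _ FX FY.
        have [[_ + _] _] := FP _ FY => /(_ x y)[||Yxy|Sxy].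
        + by left; exact: XY.
        + by left.
        + by left; exists Y.
        + by right.
      have [[_ + _] _] := FP _ FX => /(_ x y)[||Xxy|Sxy].
      + by left.
      + by left; exact: YX.
      + by left; exists X.
      + by right.
    - have [[_ + _] _] := FP _ FX => /(_ x y)[||Xxy|Sxy].
      + by left.
      + by right.
      + by left; exists X.
      + by right.
    - have [[_ + _] _] := FP _ FY => /(_ x y)[||Yxy|Sxy].
      + by right.
      + by left.
      + by left; exists Y.
      + by right.
    - by right; exact: qspanD.
  move=> q x [[X FX Xx]|Sx]; last by right; exact: qspanZ.
  have [[_ _ +] _] := FP _ FX => /(_ q x)[|Xq|Sq]; first by left.
    by left; exists X.
  by right.
exists (Y `|` qspan S); first by split => // x Sx; right.
move=> x; apply: contrapT => nx.
pose B := [set z + ratr q *: x | z in Y `|` qspan S & q in [set: rat]].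
have YB : (Y `|` qspan S) `<=` B.
  by move=> y Yy; exists y => //; exists 0 => //; rewrite rmorph0 scale0r addr0.
have BS : B `|` qspan S = B.
  by apply/setUidPl => y Sy; apply: YB; right.
apply: (Ymax B).
  split; first by move=> y Yy; apply: YB; left.
  move=> BY; apply: nx; exists 0; rewrite rmorph0 scale0r subr0; left; apply: BY.
  exists 0 => //; exists 1 => //.
  by rewrite rmorph1 scale1r add0r.
split; rewrite BS.
  split; first exact: YB.
    move=> _ _ [z Yz [q _ <-]] [w Yw [r _ <-]]; exists (z + w); first exact: YD.
    by exists (q + r) => //; rewrite rmorphD scalerDl addrACA.
  move=> r _ [z Yz [q _ <-]]; exists (ratr r *: z); first exact: YZ.
  by exists (r * q) => //; rewrite rmorphM scalerDr scalerA.
move=> [z Yz [q _ zqb]]; have [q0|q0] := eqVneq q 0.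
  by apply: Yb; rewrite -zqb q0 rmorph0 scale0r addr0.
apply: nx; exists q^-1.
have -> : x - ratr q^-1 *: b = ratr (- q^-1) *: z.
  rewrite -zqb scalerDr scalerA -rmorphM mulVf// rmorph1 scale1r rmorphN scaleNr.
  by rewrite opprD addrCA subrr addr0.
exact: YZ.
Qed.

(** The rational line of [b] is a complement of the maximal subspace [Z], and [phi] is the
    coefficient of [b] modulo [Z]. *)
Lemma qlinear_separation S b : ~ qspan S b ->
  exists phi, [/\ qlinear phi, forall x, S x -> phi x = 0 & phi b = 1].
Proof.
move=> /qspan_maximal[Z [[Z0 ZD ZZ] SZ Zb] Zq].
have [phi phiP] := choice Zq.
have ZN x : Z x -> Z (- x).
  by move=> Zx; rewrite -scaleN1r -(rmorphN1 ratr); exact: ZZ.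
have uniq x q : Z (x - ratr q *: b) -> phi x = q.
  move=> Zxq; apply: contrapT => /eqP; rewrite -subr_eq0 => d0; apply: Zb.
  have -> : b = ratr (phi x - q)^-1 *:
      ((x - ratr q *: b) - (x - ratr (phi x) *: b)).
    have -> : (x - ratr q *: b) - (x - ratr (phi x) *: b) =
      (ratr (phi x) - ratr q) *: b by vring.
    by rewrite -rmorphB scalerA -rmorphM mulVf// rmorph1 scale1r.
  by apply: ZZ; apply: ZD => //; exact: ZN.
exists phi; split; first split.
- move=> x y; apply: uniq; rewrite rmorphD scalerDl opprD addrACA; exact: ZD.
- move=> q x; apply: uniq.
  have -> : ratr q *: x - ratr (q * phi x) *: b = ratr q *: (x - ratr (phi x) *: b).
    by rewrite rmorphM; vring.
  exact: ZZ.
- move=> x Sx; apply: uniq; rewrite rmorph0 scale0r subr0; apply: SZ.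
  exact: qspan_mem.
- by apply: uniq; rewrite rmorph1 scale1r subrr.
Qed.

Lemma qspan_range m (g : 'I_m -> V) x : qspan (range g) x ->
  exists q : 'I_m -> rat, x = \sum_i ratr (q i) *: g i.
Proof.
elim=> [|_ [i _ <-]|y z _ [q ->] _ [r ->]|c y _ [q ->]].
- by exists (fun=> 0); rewrite big1// => i _; rewrite rmorph0 scale0r.
- exists (fun j => (j == i)%:R); rewrite (bigD1 i)//= eqxx rmorph1 scale1r.
  by rewrite big1 ?addr0// => j /negbTE ->; rewrite rmorph0 scale0r.
- exists (fun i => q i + r i); rewrite -big_split; apply: eq_bigr => i _.
  by rewrite rmorphD scalerDl.
- exists (fun i => c * q i); rewrite scaler_sumr; apply: eq_bigr => i _.
  by rewrite rmorphM scalerA.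
Qed.

(** This expresses independence over the rationals, by coordinate functions defined on the whole of
    [V]. *)
Definition dual_functionals m (g : 'I_m -> V) (phi : 'I_m -> V -> rat) :=
  (forall i, qlinear (phi i)) /\ (forall i j, phi i (g j) = (i == j)%:R).

Lemma qspan_dual m (g : 'I_m -> V) phi x : dual_functionals g phi ->
  qspan (range g) x -> x = \sum_i ratr (phi i x) *: g i.
Proof.
move=> [phiQ phig] /qspan_range[q xq]; rewrite {1}xq; apply: eq_bigr => i _.
rewrite xq qlinear_sum// (bigD1 i)//= (phiQ i).2 phig eqxx mulr1.
by rewrite big1 ?addr0// => j /negbTE ji; rewrite (phiQ i).2 phig eq_sym ji mulr0.
Qed.

Definition zspan m (g : 'I_m -> V) : set V :=
  [set x | exists n : 'I_m -> int, x = \sum_i (n i)%:~R *: g i].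

Lemma common_denominator (I : finType) (q : I -> rat) :
  exists2 N : nat, (0 < N)%N & forall i, q i * N%:R \is a Num.int.
Proof.
exists (\prod_i `|denq (q i)|)%N.
  by rewrite prodn_gt0// => i; rewrite absz_gt0 denq_neq0.
move=> i; rewrite (bigD1 i)//= natrM mulrA rpredM ?rpred_nat//.
rewrite pmulrn gtz0_abs ?denq_gt0// -{1}(divq_num_den (q i)).
by rewrite divfK ?rpred_int// intr_eq0 denq_neq0.
Qed.

End RationalSpans.

Section IntegerSpans.
Context {R : realType} {V : vectType R} (m : nat) (g : 'I_m -> V).

Lemma zspan0 : zspan g 0.
Proof. by exists (fun=> 0); rewrite big1// => i _; rewrite scale0r. Qed.

Lemma zspanB x y : zspan g x -> zspan g y -> zspan g (x - y).
Proof.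
move=> [a ->] [b ->]; exists (fun i => a i - b i).
by rewrite -sumrB; apply: eq_bigr => i _; rewrite intrB scalerBl.
Qed.

Lemma zspan_mem i : zspan g (g i).
Proof.
exists (fun j => (j == i)%:Z); rewrite (bigD1 i)//= eqxx scale1r big1 ?addr0//.
by move=> j /negbTE ->; rewrite scale0r.
Qed.

End IntegerSpans.

Lemma finite_vnorm_bounded (R : realType) (V : vectType R) (F : set V) :
  finite_set F -> exists r, forall x, F x -> vnorm x <= r.
Proof.
move=> /finite_seqP[s ->]; exists (\sum_(x <- s) vnorm x) => x /= xs.
by rewrite (big_rem x)//= lerDl sumr_ge0// => y _; exact: vnorm_ge0.
Qed.

(** * Minimal generating families of an approximate subring *)

Section ApproximateSubrings.
Context {R : realType} {A : fdRealAlgType R} (L : set A).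
Hypothesis L_approx : approximate_subring L.

Lemma approximate_subring_opp x : L x -> L (- x).
Proof. by case: L_approx => _ LN _ Lx; rewrite -LN; exists x. Qed.

Lemma approximate_subring_cover : exists F : set A, [/\ finite_set F,
  forall x y, L x -> L y -> exists f z, [/\ F f, L z & x - y = f + z] &
  forall x y, L x -> L y -> exists f z, [/\ F f, L z & amul x y = f + z]].
Proof.
case: L_approx => _ _ [F Ff LF]; exists F; split => // x y Lx Ly.
  have [|f Ff' [z Lz <-]] := LF (x - y); last by exists f, z.
  by right; exists x => //; exists (- y) => //; exact: approximate_subring_opp.
have [|f Ff' [z Lz <-]] := LF (amul x y); last by exists f, z.
by left; exists x => //; exists y.
Qed.

Lemma qlinear_amull (phi : A -> rat) a :
  qlinear phi -> qlinear (fun x => phi (amul a x)).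
Proof.
by move=> [pD pZ]; split=> [x y|q x]; [rewrite amulDr pD|rewrite amulZr pZ].
Qed.

Lemma qlinear_amulr (phi : A -> rat) a :
  qlinear phi -> qlinear (fun x => phi (amul x a)).
Proof.
by move=> [pD pZ]; split=> [x y|q x]; [rewrite amulDl pD|rewrite amulZl pZ].
Qed.

Section Minimal.
Variables (m : nat) (g : 'I_m -> A).
Hypothesis gL : forall i, qspan L (g i).
Hypothesis Lg : covered_by_translates L (zspan g).
Hypothesis gmin : forall k (h : 'I_k -> A), (forall i, qspan L (h i)) ->
  covered_by_translates L (zspan h) -> (m <= k)%N.

(** If [phi] is nonzero at [g j], project the other generators along [g j] to the kernel of [phi].
    This shorter family still works: as [phi] has finitely many values on [L], only finitely many
    multiples of [g j] are lost, and they join the translates. *)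
Lemma finite_functional_vanish (phi : A -> rat) :
  qlinear phi -> finite_set (phi @` L) -> forall i, phi (g i) = 0.
Proof.
move=> phiQ phiL j; apply: contrapT => /eqP c0.
case: m g gL Lg gmin j c0 => [|k] h hL Lh hmin j c0; first by case: j c0.
have [F Ff LF] := Lh; set c := phi (h j) in c0.
pose h' i := h (lift j i) + ratr (- (phi (h (lift j i)) / c)) *: h j.
suff : (k.+1 <= k)%N by rewrite ltnn.
apply: (hmin k h') => [i|]; first by apply: qspanD => //; exact: qspanZ.
(* [t f q] restores the component along [h j] of a point of [f + zspan h] where [phi] takes the
   value [q]. *)
pose t f q := f + ratr ((q - phi f) / c) *: h j : A.
exists [set t f q | f in F & q in phi @` L]; first exact: finite_image2.
move=> x Lx; have [f Ff' [_ [n ->] xE]] := LF _ Lx.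
exists (t f (phi x)); first by exists f => //; exists (phi x) => //; exists x.
exists (\sum_i (n (lift j i))%:~R *: h' i); first by exists (fun i => n (lift j i)).
rewrite -[RHS]xE /t -addrA; congr (f + _).
have -> : phi x - phi f = \sum_i (n i)%:~R * phi (h i).
  rewrite -xE phiQ.1 addrC addKr qlinear_sum//.
  by apply: eq_bigr => i _; rewrite qlinear_int.
rewrite [in RHS](bigD1_ord j)//= [in LHS](bigD1_ord j)//= -/c.
rewrite mulrDl mulfK// rmorphD /= ratr_int scalerDl -addrA; congr (_ + _).
rewrite mulr_suml rmorph_sum scaler_suml -big_split; apply: eq_bigr => i _ /=.
rewrite /h' scalerDr addrCA scalerA -scalerDl -(ratr_int R) -rmorphM -rmorphD.
by rewrite mulrN mulrA subrr rmorph0 scale0r addr0.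
Qed.

(** If [g j] were a rational combination of the others, these divided by a common denominator would
    form a shorter family. Hence [qlinear_separation] applies. *)
Lemma minimal_dual_functionals : exists phi, dual_functionals g phi.
Proof.
suff indep j : exists phi, qlinear phi /\ forall i, phi (g i) = (j == i)%:R.
  by have [phi phiP] := choice indep; exists phi; split=> [i|i j]; have [] := phiP i.
have [|phi [phiQ phi0 phi1]] := @qlinear_separation R A (g @` [set~ j]) (g j).
  case: m g gL Lg gmin j => [|k] h hL Lh hmin j; first by case: j.
  move=> hj; suff : (k.+1 <= k)%N by rewrite ltnn.
  have sub : h @` [set~ j] = range (fun i => h (lift j i)).
    apply/seteqP; split => _ [i ij <-]; last first.
      by exists (lift j i) => //= /eqP; rewrite eq_sym (negbTE (neq_lift _ _)).
    by case: (unliftP j i) => [i' ->|/ij//]; exists i'.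
  move: hj; rewrite sub => /qspan_range[q hjE].
  have [N N0 qN] := common_denominator q.
  have NR : N%:R != 0 :> R by rewrite pnatr_eq0 -lt0n.
  apply: (hmin k (fun i => ratr N%:R^-1 *: h (lift j i))) => [i|].
    exact: qspanZ.
  have [F Ff LF] := Lh; exists F => // x /LF[f Ff' [_ [n ->] <-]].
  exists f => //; exists (\sum_i (n i)%:~R *: h i) => //.
  exists (fun i => n j * Num.floor (q i * N%:R) + n (lift j i) * N%:Z).
  rewrite (bigD1_ord j)//= hjE scaler_sumr -big_split; apply: eq_bigr => i _ /=.
  rewrite !scalerA -scalerDl; congr (_ *: _).
  rewrite intrD !intrM -[(Num.floor _)%:~R in RHS](ratr_int R) floorK//.
  by rewrite rmorphM fmorphV /= !ratr_nat -pmulrn; field.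
exists phi; split=> // i; have [<-//|/eqP ji] := eqVneq j i.
by rewrite phi0//; exists i => // /esym.
Qed.

Lemma minimal_mul_mem a i : L a ->
  qspan (range g) (amul a (g i)) /\ qspan (range g) (amul (g i) a).
Proof.
move=> La; have [F [Ff _ LM]] := approximate_subring_cover; have [F' Ff' LF'] := Lg.
(* The products of [a] with [L] lie in [F + F' + zspan g], and [phi] vanishes on the last
   summand. *)
have fin phi : qlinear phi -> (forall x, range g x -> phi x = 0) ->
    finite_set [set phi (amul a x) | x in L] /\
    finite_set [set phi (amul x a) | x in L].
  move=> phiQ phig.
  have fin2 : finite_set [set phi f + phi f' | f in F & f' in F'].
    exact: finite_image2.
  have mem f z : F f -> L z -> [set phi f + phi f' | f in F & f' in F'] (phi (f + z)).
    move=> ? Lz; have [f' ? [w [n ->] <-]] := LF' _ Lz.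
    exists f => //; exists f' => //; rewrite !phiQ.1 qlinear_sum// big1 ?addr0//.
    by move=> j _; rewrite qlinear_int// phig ?mulr0//; exists j.
  split; apply: sub_finite_set fin2 => _ [x Lx <-].
    by have [f [z [? ? ->]]] := LM _ _ La Lx; exact: mem.
  by have [f [z [? ? ->]]] := LM _ _ Lx La; exact: mem.
split; apply: contrapT => /qlinear_separation[phi [phiQ phi0 phi1]];
  have [finl finr] := fin _ phiQ phi0.
  have := finite_functional_vanish (qlinear_amull a phiQ) finl i.
  by rewrite phi1 => /eqP; rewrite oner_eq0.
have := finite_functional_vanish (qlinear_amulr a phiQ) finr i.
by rewrite phi1 => /eqP; rewrite oner_eq0.
Qed.

End Minimal.

End ApproximateSubrings.

Lemma amul0l (R : realType) (A : fdRealAlgType R) (x : A) : amul 0 x = 0.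
Proof. by apply: (addrI (amul 0 x)); rewrite -amulDl !addr0. Qed.

Lemma amul0r (R : realType) (A : fdRealAlgType R) (x : A) : amul x 0 = 0.
Proof. by apply: (addrI (amul x 0)); rewrite -amulDr !addr0. Qed.

Lemma amul_suml (R : realType) (A : fdRealAlgType R) (I : finType) (F : I -> A) x :
  amul (\sum_i F i) x = \sum_i amul (F i) x.
Proof.
apply: (big_ind2 (fun a b => amul a x = b)) => [|a b c d <- <-|//].
  exact: amul0l.
exact: amulDl.
Qed.

Lemma amul_sumr (R : realType) (A : fdRealAlgType R) (I : finType) (F : I -> A) x :
  amul x (\sum_i F i) = \sum_i amul x (F i).
Proof.
apply: (big_ind2 (fun a b => amul x a = b)) => [|a b c d <- <-|//].
  exact: amul0r.
exact: amulDr.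
Qed.

Lemma qspan_trans (R : realType) (V : vectType R) (S T : set V) x :
  S `<=` qspan T -> qspan S x -> qspan T x.
Proof.
move=> ST; elim=> [|y /ST//|y z _ ? _ ?|q y _ ?].
- exact: qspan0.
- exact: qspanD.
- exact: qspanZ.
Qed.

Lemma uniformly_discrete_vnorm (R : realType) (A : fdRealAlgType R) (L : set A) :
  uniformly_discrete L -> exists2 e : R, 0 < e &
    forall x y, L x -> L y -> vnorm (x - y) < e -> x = y.
Proof.
move=> [W /nbhs0_vnorm[e e0 eW] WL]; exists e => // x y Lx Ly xye.
apply: contrapT => xy; suff : (set0 : set A) x by [].
rewrite -(WL _ _ Lx Ly xy); split.
  by exists 0; rewrite ?addr0//; apply: eW; rewrite vnorm0.
by exists (x - y); [exact: eW|vring].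
Qed.

Lemma uniformly_discrete_finite (R : realType) (A : fdRealAlgType R) (L : set A) r :
  uniformly_discrete L -> finite_set [set x | L x /\ vnorm x <= r].
Proof.
move=> /uniformly_discrete_vnorm[e e0 Le].
by apply: (separated_finite (r := r) e0) => [x []//|x y [Lx _] [Ly _]]; exact: Le.
Qed.

(** * Existence of an integral basis *)

Section IntegralBasis.
Context {R : realType} {A : fdRealAlgType R} (L : set A).
Hypotheses (L_approx : approximate_subring L) (L_discrete : uniformly_discrete L).

(** The steps [s] of the walk and its corrections form the family, so the walk stays in both [L] and
    [zspan g], and comes near any point of [L]. The remaining difference is, up to [F], a bounded
    point of [L], hence one of finitely many by discreteness. *)
Lemma approximate_subring_generators : exists m (g : 'I_m -> A),
  (forall i, qspan L (g i)) /\ covered_by_translates L (zspan g).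
Proof.
have L0 : L 0 by case: L_approx.
have [F [Ff LB _]] := approximate_subring_cover L_approx.
have [C FC] := finite_vnorm_bounded Ff.
have XB x y : L x -> L y -> exists2 z, L z & vnorm (x - y - z) <= C.
  move=> Lx Ly; have [f [z [Ff' Lz ->]]] := LB _ _ Lx Ly.
  by exists z => //; rewrite addrK; exact: FC.
have [U [r [D [s [LU sL walk]]]]] := schreiber L0 XB.
(* A correction equals [a - l - z] with all three in [L], so it lies in the rational span of [L]. *)
pose F' := F `&` qspan L.
have /finite_seqP[s' F's'] : finite_set F' by exact: finite_setIl.
pose t := s ++ s'; pose g (i : 'I_(size t)) := t`_i.
have tg x : x \in t -> zspan g x.
  move=> xt; have tx : (index x t < size t)%N by rewrite index_mem.
  by have := zspan_mem g (Ordinal tx); rewrite /g /= nth_index.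
have tL x : x \in t -> qspan L x.
  rewrite mem_cat => /orP[/sL|xs']; first exact: qspan_mem.
  by have [] : F' x by rewrite F's'.
exists (size t), g; split=> [i|]; first exact/tL/mem_nth.
pose Y := L `&` zspan g.
have Ystep a l : Y a -> l \in s -> exists2 b, Y b & vnorm (a - l - b) <= C.
  move=> [La ga] ls; have [f [z [Ff' Lz E]]] := LB _ _ La (sL _ ls).
  have F'f : F' f.
    split=> //; have -> : f = ratr 1 *: a + ratr (-1) *: l + ratr (-1) *: z.
      by rewrite rmorphN1 rmorph1 !scaleN1r scale1r E addrK.
    by repeat apply: qspanD; apply: qspanZ; apply: qspan_mem => //; exact: sL.
  exists z; last by rewrite E addrK; exact: FC.
  split=> //; have -> : z = a - l - f by rewrite E addrC addKr.
  apply: zspanB; first by apply: zspanB => //; apply: tg; rewrite mem_cat ls.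
  by apply: tg; rewrite mem_cat; move: F'f; rewrite F's' => /= ->; rewrite orbT.
pose E := [set x | L x /\ vnorm x <= r + D + C].
have finE : finite_set E by exact: uniformly_discrete_finite.
exists [set f + z | f in F & z in E]; first exact: finite_image2.
move=> x Lx; have [u uU xu] := LU _ Lx.
have [|a [La ga] ua] := walk Y 0 (conj L0 (zspan0 g)) _ Ystep u uU.
  by move=> ? [].
have [f [z [Ff' Lz xaE]]] := LB _ _ Lx La.
exists (f + z); last by exists a => //; rewrite -xaE subrK.
exists f => //; exists z => //; split => //.
have -> : z = (x - u) + (u - a) - f by rewrite subrKA xaE addrC addKr.
apply: le_trans (ler_vnormB _ _) _; apply: lerD; last exact: FC.
by apply: le_trans (ler_vnormD _ _) _; exact: lerD.
Qed.

Record integral_basis m (g : 'I_m -> A) (phi : 'I_m -> A -> rat)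
    (c : 'I_m -> 'I_m -> 'I_m -> int) : Prop := {
  ib_dual : dual_functionals g phi;
  ib_mul : forall i j, amul (g i) (g j) = \sum_k (c i j k)%:~R *: g k;
  ib_span : forall i, qspan L (g i);
  ib_cover : covered_by_translates L (zspan g);
  ib_mem : forall a i, L a ->
    qspan (range g) (amul a (g i)) /\ qspan (range g) (amul (g i) a) }.

(** Divide the coefficients by [N]: the remainders yield finitely many [f]. *)
Lemma zspan_scale_cover (V : vectType R) m (g : 'I_m -> V) (N : nat) :
  (0 < N)%N -> exists2 F : set V, finite_set F &
    forall x, zspan g x -> exists2 f, F f &
      zspan (fun i => N%:R *: g i) (x - f).
Proof.
case: N => // N _.
exists (range (fun r : {ffun 'I_m -> 'I_N.+1} => \sum_i (r i)%:R *: g i)).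
  exact/finite_image/finite_finset.
move=> _ [n ->]; pose r := [ffun i => inord `|(n i %% N.+1%:Z)%Z|%N : 'I_N.+1].
exists (\sum_i (r i)%:R *: g i); first by exists r.
exists (fun i => (n i %/ N.+1%:Z)%Z); rewrite -sumrB; apply: eq_bigr => i _.
rewrite scalerA -scalerBl; congr (_ *: _).
have n0 : (0 <= n i %% N.+1%:Z)%Z by exact: modz_ge0.
rewrite /r ffunE inordK; last first.
  by rewrite -ltz_nat gez0_abs// ltz_pmod.
rewrite [X in _ - X]pmulrn gez0_abs// {1}(divz_eq (n i) N.+1%:Z) intrD intrM.
by rewrite addrK.
Qed.

Lemma exists_integral_basis : exists m g phi c, @integral_basis m g phi c.
Proof.
pose P m := `[< exists g : 'I_m -> A,
  (forall i, qspan L (g i)) /\ covered_by_translates L (zspan g) >].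
have exP : exists m, P m.
  by have [m gP] := approximate_subring_generators; exists m; exact/asboolP.
case: (ex_minnP exP) => m /asboolP[g [gL Lg]] Pmin.
have {exP} gmin k (h : 'I_k -> A) : (forall i, qspan L (h i)) ->
    covered_by_translates L (zspan h) -> (m <= k)%N.
  by move=> hL Lh; apply: Pmin; apply/asboolP; exists h.
have [phi phig] := minimal_dual_functionals gL Lg gmin.
have Lmem a i (La : L a) := minimal_mul_mem L_approx gL Lg gmin i La.
(* Stability under multiplication by [L] passes to [qspan L], where the [g i] lie. *)
have gmem i j : qspan (range g) (amul (g i) (g j)).
  elim: (gL i) => [|a La|a b _ ? _ ?|q a _ ?].
  - by rewrite amul0l; exact: qspan0.
  - by have [] := Lmem a j La.
  - by rewrite amulDl; exact: qspanD.
  - by rewrite amulZl; exact: qspanZ.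
(* Passing from [g] to [N%:R *: g] multiplies the structure constants by [N], which clears their
   denominators. *)
have [N N0 NP] := common_denominator
  (fun ijk : 'I_m * 'I_m * 'I_m => phi ijk.2 (amul (g ijk.1.1) (g ijk.1.2))).
have NR : N%:R != 0 :> R by rewrite pnatr_eq0 -lt0n.
have NQ : N%:R != 0 :> rat by rewrite pnatr_eq0 -lt0n.
pose g' i := N%:R *: g i.
have g'E i : g' i = ratr N%:R *: g i by rewrite ratr_nat.
have gg' : range g `<=` qspan (range g').
  move=> _ [i _ <-]; have -> : g i = ratr N%:R^-1 *: g' i.
    by rewrite /g' fmorphV /= ratr_nat scalerA mulVf// scale1r.
  by apply: qspanZ; apply: qspan_mem; exists i.
exists m, g', (fun i x => phi i x / N%:R), (fun i j k =>
  Num.floor (phi k (amul (g i) (g j)) * N%:R)); split.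
- split=> [i|i j]; first split=> [x y|q x].
  + by rewrite (phig.1 i).1 mulrDl.
  + by rewrite (phig.1 i).2 mulrA.
  + by rewrite g'E (phig.1 i).2 phig.2 mulrAC mulfV// mul1r.
- move=> i j; rewrite /g' amulZl amulZr {1}(qspan_dual phig (gmem i j)).
  rewrite !scaler_sumr; apply: eq_bigr => k _; rewrite -(ratr_int R) floorK; last first.
    exact: (NP (i, j, k)).
  by rewrite rmorphM /= ratr_nat !scalerA; congr (_ *: _); ring.
- by move=> i; rewrite g'E; exact: qspanZ.
- have [F Ff LF] := Lg; have [F' Ff' gF'] := zspan_scale_cover g N0.
  exists [set f + f' | f in F & f' in F']; first exact: finite_image2.
  move=> x /LF[f Ff1 [z gz <-]]; have [f' Ff2 g'z] := gF' _ gz.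
  exists (f + f'); first by exists f => //; exists f'.
  by exists (z - f') => //; rewrite -addrA [f' + _]addrC subrK.
- move=> a i La; have [l r] := Lmem _ i La; split.
    by rewrite g'E amulZr; apply: qspanZ; exact: qspan_trans l.
  by rewrite g'E amulZl; apply: qspanZ; exact: qspan_trans r.
Qed.

End IntegralBasis.

(** * Algebras with integer structure constants *)

Definition associative_constants m (c : 'I_m -> 'I_m -> 'I_m -> int) :=
  forall i j k s, \sum_l c i j l * c l k s = \sum_l c j k l * c i l s.

(* The real algebra with basis [e_i] and product
   [e_i e_j = \sum_k c_ijk e_k]. *)
Definition structure_algebra (R : realType) m (c : 'I_m -> 'I_m -> 'I_m -> int)
  (cA : associative_constants c) : Type := 'rV[R]_m.

Section StructureAlgebra.
Context {R : realType} {m : nat} {c : 'I_m -> 'I_m -> 'I_m -> int}.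
Variable cA : associative_constants c.
Local Notation B := (structure_algebra R cA).

HB.instance Definition _ := Vector.copy B 'rV[R]_m.

(** The matrix of left multiplication by [x]. It acts on row vectors from the right, hence the
    reversed order in [lmxM], which amounts to associativity. *)
Let lmx (x : B) : 'M[R]_m := \matrix_(j, k) \sum_i x 0 i * (c i j k)%:~R.

Let lmxD x y : lmx (x + y) = lmx x + lmx y.
Proof.
apply/matrixP => j k; rewrite !mxE -big_split; apply: eq_bigr => i _.
by rewrite !mxE mulrDl.
Qed.

Let lmxZ (a : R) x : lmx (a *: x) = a *: lmx x.
Proof.
apply/matrixP => j k; rewrite !mxE mulr_sumr; apply: eq_bigr => i _.
by rewrite !mxE mulrA.
Qed.

Let mul (x y : B) : B := y *m lmx x.

Let lmxM x y : lmx (mul x y) = lmx y *m lmx x.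
Proof.
apply/matrixP => j k; rewrite !mxE.
(* Both sides become sums over [a] and [b] of [y 0 b * x 0 a] times one side of
   [associative_constants]. *)
transitivity (\sum_b \sum_a y 0 b * x 0 a * (\sum_l c a b l * c l j k)%:~R).
  under eq_bigr => l _.
    rewrite !mxE mulr_suml.
    under eq_bigr => b _ do rewrite !mxE mulr_sumr mulr_suml.
    over.
  rewrite exchange_big; apply: eq_bigr => b _.
  rewrite exchange_big; apply: eq_bigr => a _.
  rewrite rmorph_sum mulr_sumr; apply: eq_bigr => l _.
  by rewrite rmorphM /= !mulrA.
symmetry; under eq_bigr => l _ do rewrite !mxE big_distrlr.
rewrite exchange_big; apply: eq_bigr => b _.
rewrite exchange_big; apply: eq_bigr => a _.
rewrite cA rmorph_sum mulr_sumr; apply: eq_bigr => l _.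
by rewrite rmorphM /=; ring.
Qed.

Let mulA : associative mul.
Proof. by move=> x y z; rewrite /mul -/(mul x y) lmxM mulmxA. Qed.

Let mulDl : left_distributive mul +%R.
Proof. by move=> x y z; rewrite /mul lmxD mulmxDr. Qed.

Let mulDr : right_distributive mul +%R.
Proof. by move=> x y z; rewrite /mul mulmxDl. Qed.

Let mulZl (a : R) x y : mul (a *: x) y = a *: mul x y.
Proof. by rewrite /mul lmxZ -scalemxAr. Qed.

Let mulZr (a : R) x y : mul x (a *: y) = a *: mul x y.
Proof. by rewrite /mul -scalemxAl. Qed.

HB.instance Definition _ :=
  Vector_isRealAlgebra.Build R B mulA mulDl mulDr mulZl mulZr.

Lemma structure_amulE (x y : B) k :
  (amul x y : 'rV_m) 0 k =
  \sum_j \sum_i y 0 j * x 0 i * (c i j k)%:~R.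
Proof.
rewrite /amul/= /mul mxE; apply: eq_bigr => j _; rewrite mxE mulr_sumr.
by apply: eq_bigr => i _; rewrite mulrA.
Qed.

(** [vnorm] is taken in the coordinates [v2r], which are not presumed to be the entries of the row;
    the l1 norm of the entries serves for comparison. *)
Lemma structure_coord_vnorm :
  exists2 k : R, 0 <= k & forall (x : B) i, `|x 0 i| <= k * vnorm x.
Proof.
have [x y|a x|k k0 kP] := @seminorm_vnorm R B (fun x : B => \sum_i `|x 0 i|).
- by rewrite -big_split; apply: ler_sum => i _; rewrite mxE ler_normD.
- by rewrite mulr_sumr; apply: eq_bigr => i _; rewrite mxE normrM.
exists k => // x i; apply: le_trans (kP x).
by rewrite (bigD1 i)//= lerDl sumr_ge0.
Qed.

Definition integer_points : set B := [set x | forall i, x 0 i \is a Num.int].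

Lemma integer_pointsB x y :
  integer_points x -> integer_points y -> integer_points (x - y).
Proof. by move=> xZ yZ i; rewrite !mxE rpredB. Qed.

Lemma integer_points_subring : is_subring integer_points.
Proof.
split=> [i||x y xZ yZ k]; first by rewrite mxE.
  exact: integer_pointsB.
rewrite structure_amulE; apply: rpred_sum => j _; apply: rpred_sum => i _.
by rewrite !rpredM// intr_int.
Qed.

Lemma integer_points_separated : exists2 e : R, 0 < e & forall x y : B,
  integer_points x -> integer_points y -> vnorm (x - y) < e -> x = y.
Proof.
have [k k0 kP] := structure_coord_vnorm.
have k1 : 0 < k + 1 by lra.
exists (k + 1)^-1; first by rewrite invr_gt0.
move=> x y xZ yZ xye; apply/eqP; rewrite -subr_eq0; apply/eqP/rowP => i.
rewrite [RHS]mxE; apply: contrapT => /eqP xyi.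
have := norm_intr_ge1 (integer_pointsB xZ yZ i) xyi.
have := kP (x - y) i; have := vnorm_ge0 (x - y).
move: xye; rewrite -[_^-1]mul1r ltr_pdivlMr//; nra.
Qed.

Lemma integer_points_discrete : uniformly_discrete integer_points.
Proof.
have [e e0 eP] := integer_points_separated.
exists [set x | vnorm x < e / 2]; first by apply: vnorm_ball_nbhs0; lra.
move=> x y xZ yZ xy; apply/seteqP; split => // _ [[w /= we <-] [w' /= w'e E]].
apply: xy; apply: eP => //; have -> : x - y = w' - w.
  have -> : x - y = (x + w) - y - w by vring.
  by rewrite -E; vring.
by apply: le_lt_trans (ler_vnormB _ _) _; lra.
Qed.

Lemma structure_sum_delta (x : B) : x = \sum_i x 0 i *: (delta_mx 0 i : B).
Proof. exact: row_sum_delta. Qed.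

Lemma integer_points_cocompact : cocompact integer_points.
Proof.
exists [set x | vnorm x <= \sum_i vnorm (delta_mx 0 i : B)].
  exact: compact_vnorm_ball.
apply/seteqP; split => // x _; pose f : B := \row_i (Num.floor (x 0 i))%:~R.
exists f; first by move=> i; rewrite mxE intr_int.
exists (x - f); last by rewrite addrC subrK.
rewrite /= [x - f]structure_sum_delta; apply: le_trans (ler_vnorm_sum _) _.
apply: ler_sum => i _; rewrite vnormZ -[leRHS]mul1r.
apply: ler_wpM2r; first exact: vnorm_ge0.
by rewrite !mxE; have := floor_itv (x 0 i); rewrite intrD1 ler_norml; lra.
Qed.

End StructureAlgebra.

(** * The model *)

(** The component of [y] outside [U], read off by [1 - projv U], has bounded multiples and so
    vanishes. *)
Lemma memv_bounded_multiples (R : realType) (V : vectType R) (U : {vspace V}) y K :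
  (forall n : nat, exists2 u, u \in U & vnorm (n%:R *: y - u) <= K) -> y \in U.
Proof.
move=> yK; pose f : 'End(V) := \1%VF - projv U.
have fE x : f x = x - projv U x by rewrite add_lfunE opp_lfunE id_lfunE.
have [k k0 kP] := linear_vnorm f.
have fU u : u \in U -> f u = 0 by move=> uU; rewrite fE projv_id ?subrr.
suff : f y = 0 by rewrite fE => /subr0_eq ->; exact: memv_proj.
apply/eqP; rewrite -vnorm_eq0; apply/negPn/negP => fy0.
have fy : 0 < vnorm (f y) by rewrite lt0r fy0 vnorm_ge0.
have := truncnS_gt (k * K / vnorm (f y)); set n := _.+1.
rewrite ltr_pdivrMr// ltNge => /negP; apply.
have [u uU uK] := yK n.
have -> : n%:R * vnorm (f y) = vnorm (f (n%:R *: y - u)).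
  by rewrite linearB linearZ /= (fU u)// subr0 vnormZ ger0_norm.
by apply: le_trans (kP _) _; exact: ler_wpM2l.
Qed.

Section Model.
Context {R : realType} {A : fdRealAlgType R} (L : set A).
Hypotheses (L_approx : approximate_subring L) (L_discrete : uniformly_discrete L).
Context {m : nat} {g : 'I_m -> A} {phi : 'I_m -> A -> rat}.
Context {c : 'I_m -> 'I_m -> 'I_m -> int} (gP : integral_basis L g phi c).

Let phiQ i : qlinear (phi i) := (ib_dual gP).1 i.

(** Compare the coordinates [phi s] of the two bracketings of the product of [g i], [g j] and
    [g k]. *)
Lemma integral_basis_assoc : associative_constants c.
Proof.
move=> i j k s.
have phi_sum (a : 'I_m -> int) : phi s (\sum_l (a l)%:~R *: g l) = (a s)%:~R.
  rewrite qlinear_sum// (bigD1 s)//= qlinear_int// (ib_dual gP).2 eqxx mulr1.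
  rewrite big1 ?addr0// => l /negbTE ls.
  by rewrite qlinear_int// (ib_dual gP).2 eq_sym ls mulr0.
have phi_mull (a : 'I_m -> int) : phi s (\sum_l (a l)%:~R *: amul (g l) (g k)) =
    (\sum_l a l * c l k s)%:~R.
  rewrite qlinear_sum// rmorph_sum; apply: eq_bigr => l _.
  by rewrite qlinear_int// (ib_mul gP) phi_sum rmorphM.
have phi_mulr (a : 'I_m -> int) : phi s (\sum_l (a l)%:~R *: amul (g i) (g l)) =
    (\sum_l a l * c i l s)%:~R.
  rewrite qlinear_sum// rmorph_sum; apply: eq_bigr => l _.
  by rewrite qlinear_int// (ib_mul gP) phi_sum rmorphM.
apply: (@intr_inj rat); rewrite -phi_mull -phi_mulr; congr phi.
transitivity (amul (amul (g i) (g j)) (g k)).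
  by rewrite (ib_mul gP) amul_suml; apply: eq_bigr => l _; rewrite amulZl.
rewrite -amulA (ib_mul gP j) amul_sumr.
by apply: eq_bigr => l _; rewrite amulZr.
Qed.

Local Notation B := (structure_algebra R integral_basis_assoc : Type).
Local Notation D := (@integer_points R m c integral_basis_assoc).

Definition basis_eval (x : B) : A := \sum_i x 0 i *: g i.

Let basis_eval_is_linear : linear basis_eval.
Proof.
move=> a x y; rewrite /basis_eval scaler_sumr -big_split; apply: eq_bigr => i _.
by rewrite !mxE scalerDl scalerA.
Qed.

HB.instance Definition _ :=
  GRing.isLinear.Build R B A _ basis_eval basis_eval_is_linear.

Definition model_hom : 'Hom(B, A) := linfun basis_eval.

Lemma model_homE x : model_hom x = \sum_i x 0 i *: g i.
Proof. by rewrite lfunE. Qed.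

Lemma model_hom_alg : is_algebra_hom model_hom.
Proof.
move=> x y; rewrite !model_homE amul_suml.
transitivity (\sum_i \sum_j \sum_k (y 0 j * x 0 i * (c i j k)%:~R) *: g k).
  under eq_bigr => k _.
    rewrite structure_amulE scaler_suml.
    under eq_bigr => j _ do rewrite scaler_suml.
    over.
  rewrite exchange_big /=; under eq_bigr => j _ do rewrite exchange_big /=.
  by rewrite exchange_big.
apply: eq_bigr => i _; rewrite amulZl amul_sumr scaler_sumr.
apply: eq_bigr => j _; rewrite amulZr (ib_mul gP) !scaler_sumr.
by apply: eq_bigr => k _; rewrite !scalerA; congr (_ *: _); ring.
Qed.

(* A one-sided inverse of [model_hom] on the rational span of [g]; only
   rational-linear, hence unbounded in general. *)
Definition lift (y : A) : B := \row_i ratr (phi i y).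

Lemma liftD x y : lift (x + y) = lift x + lift y.
Proof. by apply/rowP => i; rewrite !mxE (phiQ i).1 rmorphD. Qed.

Lemma liftZ q x : lift (ratr q *: x) = ratr q *: lift x.
Proof. by apply/rowP => i; rewrite !mxE (phiQ i).2 rmorphM. Qed.

Lemma liftN x : lift (- x) = - lift x.
Proof. by apply/rowP => i; rewrite !mxE qlinearN// rmorphN. Qed.

Lemma liftB x y : lift (x - y) = lift x - lift y.
Proof. by rewrite liftD liftN. Qed.

Lemma lift0 : lift 0 = 0.
Proof. by apply/rowP => i; rewrite !mxE qlinear0// rmorph0. Qed.

Lemma lift_sum (x : B) (n : 'I_m -> int) (h : 'I_m -> A) :
  (forall i, x 0 i = (n i)%:~R) ->
  lift (\sum_i x 0 i *: h i) = \sum_i x 0 i *: lift (h i).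
Proof.
move=> xn; apply: (big_ind2 (fun a b => lift a = b)).
- exact: lift0.
- by move=> a b d e <- <-; rewrite liftD.
- by move=> i _; rewrite xn -(ratr_int R) liftZ.
Qed.

Lemma integer_coordinates (x : B) : D x -> exists n : 'I_m -> int,
  forall i, x 0 i = (n i)%:~R.
Proof.
by move=> xZ; exists (fun i => Num.floor (x 0 i)) => i; rewrite floorK.
Qed.

(** This makes [model_hom] injective on the integer points, and lets relations in [A] be lifted to
    relations between them. *)
Lemma lift_model_hom (x : B) : D x -> lift (model_hom x) = x.
Proof.
move=> /integer_coordinates[n xn]; rewrite model_homE (lift_sum _ xn).
rewrite [RHS]structure_sum_delta; apply: eq_bigr => i _; congr (_ *: _).
by apply/rowP => j; rewrite !mxE (ib_dual gP).2 eq_sym ratr_nat.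
Qed.

Lemma lker_integer_points : [set` lker model_hom] `&` D = [set 0].
Proof.
apply/seteqP; split => [x [/=]|_ ->].
  by rewrite memv_ker => /eqP x0 xZ; rewrite /= -(lift_model_hom xZ) x0 lift0.
by split; [exact: mem0v|move=> i; rewrite mxE].
Qed.

(** * The lift of the approximate subring to the lattice *)

Section Cover.
Variables (E : set A) (E_fin : finite_set E).
Hypothesis L_cover : L `<=` addset E (zspan g).

(** Points of [L] lie in [zspan g] only up to [E], so the lift is made of the integer points whose
    image is a point of [L] up to [E]. *)
Definition lattice_lift : set B :=
  [set x | D x /\ exists a e, [/\ L a, E e & a = e + model_hom x]].

Local Notation X := lattice_lift.

Lemma lattice_lift_surj a : L a -> exists x e, [/\ X x, E e & a = e + model_hom x].
Proof.
move=> La; have [e Ee [_ [n ->] aE]] := L_cover La.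
pose x : B := \row_i (n i)%:~R.
have xE : model_hom x = \sum_i (n i)%:~R *: g i.
  by rewrite model_homE; apply: eq_bigr => i _; rewrite mxE.
exists x, e; rewrite xE; split => //.
by split; [move=> i; rewrite mxE intr_int|exists a, e; rewrite xE].
Qed.

Lemma lift_bounded (F : set A) : finite_set F ->
  exists r, forall y, F y -> vnorm (lift y) <= r.
Proof.
move=> Ff; have [r rP] := finite_vnorm_bounded (finite_image lift Ff).
by exists r => y Fy; apply: rP; exists y.
Qed.

(** The defect of [x - y] from [X] is a sum of lifts, up to sign, of elements of the finite sets [F]
    and [E]. On these [lift] is bounded, and it is additive on all of [A]. *)
Lemma lattice_lift_cover : exists C, forall x y, X x -> X y ->
  exists2 z, X z & vnorm (x - y - z) <= C.
Proof.
have [F [Ff LB _]] := approximate_subring_cover L_approx.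
have [rF rFP] := lift_bounded Ff; have [rE rEP] := lift_bounded E_fin.
exists (rF + rE + rE + rE) => x y [Dx [a [e [La Ee ax]]]] [Dy [b [e' [Lb Ee' by']]]].
have [f [z [Ff' Lz abE]]] := LB _ _ La Lb.
have [w [e2 [Xw Ee2 zE]]] := lattice_lift_surj Lz.
exists w => //; have Dw : D w by case: Xw.
have -> : x - y - w = lift f + lift e2 - lift e + lift e'.
  rewrite -(lift_model_hom Dx) -(lift_model_hom Dy) -(lift_model_hom Dw).
  rewrite -!liftB -liftD -liftB -liftD; congr lift.
  have -> : model_hom x = a - e by rewrite ax addrC addKr.
  have -> : model_hom y = b - e' by rewrite by' addrC addKr.
  have -> : f = a - b - z by rewrite abE addrK.
  by rewrite zE; vring.
have := ler_vnormD (lift f + lift e2 - lift e) (lift e').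
have := ler_vnormB (lift f + lift e2) (lift e).
have := ler_vnormD (lift f) (lift e2).
have := rFP _ Ff'; have := rEP _ Ee; have := rEP _ Ee'; have := rEP _ Ee2.
lra.
Qed.

(** * The subspace at bounded distance from the lift *)

Section Subspace.
Variables (I : {vspace B}) (r : R).
Hypothesis XI : forall x, X x -> exists2 u, u \in I & vnorm (x - u) <= r.
Hypothesis IX : forall u, u \in I -> exists2 x, X x & vnorm (u - x) <= r.

Lemma subspace_lker : [set` I] `&` [set` lker model_hom] = [set 0].
Proof.
apply/seteqP; split => [v [/= vI]|_ ->]; last by split; exact: mem0v.
rewrite memv_ker => /eqP v0.
have [k k0 kP] := linear_vnorm model_hom.
have [rE rEP] := lift_bounded E_fin; have [rE' rE'P] := finite_vnorm_bounded E_fin.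
(* A point [x] of the lift within [r] of [n%:R *: v] has the same image as their difference, so the
   corresponding [a] in [L] has norm at most [rE' + k * r] for every [n]. There are finitely many
   such [a], which bounds [x = lift a - lift e]. *)
have [rL rLP] := lift_bounded (uniformly_discrete_finite (rE' + k * r) L_discrete).
suff : v \in 0%VS by rewrite memv0 => /eqP ->.
apply: (@memv_bounded_multiples _ _ _ _ (r + rL + rE)) => n; exists 0; first exact: mem0v.
rewrite subr0; have [x [Dx [a [e [La Ee ax]]]] vx] := IX (memvZ n%:R vI).
have xE : model_hom x = model_hom (x - n%:R *: v).
  by rewrite linearB linearZ /= v0 scaler0 subr0.
have aL : vnorm a <= rE' + k * r.
  rewrite ax xE; apply: le_trans (ler_vnormD _ _) _; apply: lerD; first exact: rE'P.
  by apply: le_trans (kP _) _; rewrite vnormBC; exact: ler_wpM2l.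
have xle : x = lift a - lift e.
  by rewrite -liftB ax [e + _]addrC addrK lift_model_hom.
have -> : n%:R *: v = (n%:R *: v - x) + lift a - lift e.
  by rewrite -addrA -xle subrK.
have := ler_vnormB (n%:R *: v - x + lift a) (lift e).
have := ler_vnormD (n%:R *: v - x) (lift a).
have := rEP _ Ee; have := rLP a (conj La aL); lra.
Qed.

(* The real-linear extension to [B] of an operator [t], which should map [g]
   into its rational span. *)
Let act (t : A -> A) (x : B) : B := \sum_i x 0 i *: lift (t (g i)).

Let act_is_linear t : linear (act t).
Proof.
move=> a x y; rewrite /act scaler_sumr -big_split; apply: eq_bigr => i _.
by rewrite !mxE scalerDl scalerA.
Qed.

Let act_lift t x : (forall a b, t (a + b) = t a + t b) ->
  (forall k a, t (k *: a) = k *: t a) -> D x -> act t x = lift (t (model_hom x)).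
Proof.
move=> tD tZ /integer_coordinates[n xn]; rewrite /act -(lift_sum _ xn).
congr lift; rewrite model_homE; symmetry.
have t0 : t 0 = 0 by apply: (addrI (t 0)); rewrite -tD !addr0.
apply: (big_ind2 (fun a b => t a = b)) => // a b d e <- <-.
exact: tD.
Qed.

(** Let [w] in [X] be near a multiple of [x]. Up to bounded errors [act t w] is a lift of a point of
    [t] applied to [L], hence of a point of [L], and so is near [I]. Thus the multiples of [act t x]
    stay at bounded distance from [I]. *)
Lemma act_subspace t : (forall a b, t (a + b) = t a + t b) ->
  (forall k a, t (k *: a) = k *: t a) ->
  covered_by_translates (t @` L) L -> forall x, x \in I -> act t x \in I.
Proof.
move=> tD tZ [F Ff tL] x xI.
pose lin := GRing.isLinear.Build R B B _ (act t) (@act_is_linear t).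
pose actl : {linear B -> B} := HB.pack (act t) lin.
have [k k0 kP] := linear_vnorm actl.
have [rF rFP] := lift_bounded Ff; have [rE rEP] := lift_bounded E_fin.
have [rT rTP] := lift_bounded (finite_image t E_fin).
(* [k * r] pays for replacing the multiple of [x] by [w], the middle term for the finite sets, and
   the last [r] for returning from [X] to [I]. *)
apply: (@memv_bounded_multiples _ _ _ _ (k * r + (rF + rE + rT) + r)) => n.
have [w [Dw [b [e [Lb Ee bw]]]] xw] := IX (memvZ n%:R xI).
have [f Ff' [z Lz fzE]] : addset F L (t b) by apply: tL; exists b.
have [w' [e' [Xw' Ee' zE]]] := lattice_lift_surj Lz.
have [u uI w'u] := XI Xw'; exists u => //.
have Dw' : D w' by case: Xw'.
have tE : act t w = lift f + lift e' + w' - lift (t e).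
  rewrite act_lift// -(lift_model_hom Dw') -!liftD -liftB; congr lift.
  by rewrite -[f + e' + _]addrA -zE fzE bw tD addrC addKr.
have -> : n%:R *: act t x - u = actl (n%:R *: x - w) +
    (lift f + lift e' - lift (t e)) + (w' - u).
  rewrite linearB linearZ /= tE; vring.
have := ler_vnormD (actl (n%:R *: x - w) + (lift f + lift e' - lift (t e))) (w' - u).
have := ler_vnormD (actl (n%:R *: x - w)) (lift f + lift e' - lift (t e)).
have := ler_vnormB (lift f + lift e') (lift (t e)).
have := ler_vnormD (lift f) (lift e').
have := rFP _ Ff'; have := rEP _ Ee'; have := rTP (t e) (imageP t Ee).
have := le_trans (kP (n%:R *: x - w)) (ler_wpM2l k0 xw).
lra.
Qed.

(** [act_subspace] treats multiplication by elements of [L]. Sums and rational multiples extend this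
    to [qspan L], hence to the [g i], which act as the basis vectors of the algebra. *)
Lemma subspace_ideal : is_ideal I.
Proof.
have [F [Ff _ LM]] := approximate_subring_cover L_approx.
have actD t t' x : act (fun a => t a + t' a) x = act t x + act t' x.
  rewrite /act -big_split; apply: eq_bigr => i _.
  by rewrite liftD scalerDr.
have actZ q t x : act (fun a => ratr q *: t a) x = ratr q *: act t x.
  rewrite /act scaler_sumr; apply: eq_bigr => i _.
  by rewrite liftZ !scalerA mulrC.
have act0 x : act (fun=> 0) x = 0.
  by rewrite /act big1// => i _; rewrite lift0 scaler0.
have gen a : qspan L a -> forall x, x \in I ->
    act (amul a) x \in I /\ act (amul^~ a) x \in I.
  elim=> [|b Lb|b d _ IHb _ IHd|q b _ IHb] x xI.
  - rewrite (_ : amul 0 = fun=> 0); last by apply/funext => y; rewrite amul0l.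
    rewrite (_ : amul^~ 0 = fun=> 0); last by apply/funext => y; rewrite amul0r.
    by rewrite act0 mem0v.
  - split; apply: act_subspace => //.
    + exact: amulDr.
    + by move=> k y; exact: amulZr.
    + exists F => // _ [y Ly <-]; have [f [z [? ? ->]]] := LM _ _ Lb Ly.
      by exists f => //; exists z.
    + by move=> y z; exact: amulDl.
    + by move=> k y; exact: amulZl.
    + exists F => // _ [y Ly <-]; have [f [z [? ? ->]]] := LM _ _ Ly Lb.
      by exists f => //; exists z.
  - have [bl br] := IHb _ xI; have [dl dr] := IHd _ xI.
    rewrite (_ : amul (b + d) = fun y => amul b y + amul d y); last first.
      by apply/funext => y; rewrite amulDl.
    rewrite (_ : amul^~ (b + d) = fun y => amul y b + amul y d); last first.
      by apply/funext => y; rewrite amulDr.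
    by rewrite !actD !memvD.
  - have [bl br] := IHb _ xI.
    rewrite (_ : amul (ratr q *: b) = fun y => ratr q *: amul b y); last first.
      by apply/funext => y; rewrite amulZl.
    rewrite (_ : amul^~ (ratr q *: b) = fun y => ratr q *: amul y b); last first.
      by apply/funext => y; rewrite amulZr.
    by rewrite !actZ !memvZ.
(* It follows that [act (amul (g i))] is left multiplication by the basis vector of index [i], and
   similarly on the right. *)
have coef i j k : (lift (amul (g i) (g j)) : 'rV_m) 0 k = (c i j k)%:~R.
  rewrite mxE (ib_mul gP) qlinear_sum// (bigD1 k)//= qlinear_int//.
  rewrite (ib_dual gP).2 eqxx mulr1 big1 ?addr0 ?ratr_int// => l /negbTE lk.
  by rewrite qlinear_int// (ib_dual gP).2 eq_sym lk mulr0.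
move=> y x xI; split.
  have -> : amul y x = \sum_i y 0 i *: act (amul (g i)) x.
    apply/rowP => k; rewrite structure_amulE exchange_big summxE.
    apply: eq_bigr => i _; rewrite mxE summxE mulr_sumr; apply: eq_bigr => j _.
    by rewrite mxE coef; ring.
  by apply: memv_suml => i _; apply: memvZ; have [] := gen _ (ib_span gP i) _ xI.
have -> : amul x y = \sum_i y 0 i *: act (amul^~ (g i)) x.
  apply/rowP => k; rewrite structure_amulE summxE.
  apply: eq_bigr => i _; rewrite mxE summxE mulr_sumr; apply: eq_bigr => j _.
  by rewrite mxE coef; ring.
by apply: memv_suml => i _; apply: memvZ; have [] := gen _ (ib_span gP i) _ xI.
Qed.

Lemma model_set_commensurable
    (W : set (structure_algebra R integral_basis_assoc : fdRealAlgType R)) :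
  nbhs 0 W -> precompact W ->
  commensurable L (model_hom @` (D `&` addset [set` I] W)).
Proof.
move=> /nbhs0_vnorm[e e0 eW] /precompact_vnorm[M WM]; split.
  (* Points of [X] are sorted by the cell of their offset from [I]. Two points with the same cell
     differ by an element of [I] plus a vector shorter than [e], which is in [W]. *)
  have [T [cell cellP]] := vnorm_cells B r e0.
  pose Q t x := X x /\ exists u, [/\ u \in I, vnorm (x - u) <= r & cell (x - u) = t].
  have /choice[rep repP] t : exists x0, (exists x, Q t x) -> Q t x0.
    by have [[x Qx]|nQ] := pselect (exists x, Q t x); [exists x | exists 0].
  exists [set f + model_hom (rep t) | f in E & t in [set: T]].
    by apply: finite_image2 => //; exact: finite_finset.
  move=> a /lattice_lift_surj[x [f [Xx Ef ->]]]; have [u uI xu] := XI Xx.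
  pose t := cell (x - u).
  have [[Drep _] [u' [u'I repu' cellu']]] : Q t (rep t).
    by apply: repP; exists x; split => //; exists u.
  exists (f + model_hom (rep t)); first by exists f => //; exists t.
  exists (model_hom (x - rep t)); last by rewrite linearB -addrA subrKC.
  exists (x - rep t) => //; split.
    by apply: integer_pointsB => //; case: Xx.
  exists (u - u'); first exact: memvB.
  exists ((x - u) - (rep t - u')); first by apply: eW; exact: cellP.
  by vring.
(* Conversely, an integer point [u + w] with [u] in [I] and [w] in [W] differs from a point of [X]
   near [u] by an integer point of norm at most [M + r], one of finitely many. *)
have Dfin : finite_set [set x | D x /\ vnorm x <= M + r].
  exact/uniformly_discrete_finite/integer_points_discrete.
exists [set model_hom x - f | x in [set x | D x /\ vnorm x <= M + r] & f in E].
  exact: finite_image2.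
move=> _ [x [Dx [u /= uI [w Ww uwx]]] <-].
have [y [Dy [a [f [La Ef aE]]]] uy] := IX uI.
exists (model_hom (x - y) - f); last first.
  by exists a => //; rewrite aE linearB; vring.
exists (x - y); last by exists f.
split; first exact: integer_pointsB.
have -> : x - y = w + (u - y) by rewrite -uwx; vring.
by apply: le_trans (ler_vnormD _ _) _; apply: lerD; first exact: WM.
Qed.

End Subspace.
End Cover.
End Model.

Arguments model_hom {R A L m g phi c} gP.
Arguments lattice_lift {R A L m g phi c} gP E.

Theorem theorem7p6 (R : realType) (A : fdRealAlgType R) (L : set A)
    (L_approx : approximate_subring L) (L_discrete : uniformly_discrete L) :
  exists (A' : fdRealAlgType R) (D : set A') (I J : {vspace A'})
      (pi : 'Hom(A', A)),
    [/\ is_subring D, uniformly_discrete D & cocompact D] /\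
    (is_ideal I /\ is_ideal J) /\
    [set` I] `&` [set` J] = [set 0] /\
    (is_algebra_hom pi /\ lker pi = J) /\
    (forall W0 : set A', nbhs 0 W0 -> symmetric_set W0 -> precompact W0 ->
      commensurable L (pi @` (D `&` addset [set` I] W0))) /\
    [set` J] `&` D = [set 0].
Proof.
have [m [g [phi [c gP]]]] := exists_integral_basis L_approx L_discrete.
have [E E_fin L_cover] := ib_cover gP.
have [C XB] := lattice_lift_cover L_approx gP E_fin L_cover.
have L0 : L 0 by case: L_approx.
have [x0 [_ [Xx0 _ _]]] := lattice_lift_surj gP L_cover L0.
have [I [r1 [r2 [s [XI sX walk]]]]] := schreiber Xx0 XB.
pose X := lattice_lift gP E; pose r := Num.max r1 r2.
have {}XI x : X x -> exists2 u, u \in I & vnorm (x - u) <= r.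
  by move=> /XI[u uI xu]; exists u => //; rewrite le_max xu.
have IX u : u \in I -> exists2 x, X x & vnorm (u - x) <= r.
  (* Here the walk may use the whole of [X], so it comes near every point of the cone. *)
  move=> uI; have [||x Xx ux] := walk _ _ Xx0 _ _ _ uI => //.
    by move=> a l Xa /sX; exact: XB.
  by exists x => //; rewrite le_max ux orbT.
exists (structure_algebra R (integral_basis_assoc gP)), 
  (@integer_points R m c (integral_basis_assoc gP)), I,
  (lker (model_hom gP)), (model_hom gP).
split.
  split; [exact: integer_points_subring|exact: integer_points_discrete|].
  exact: integer_points_cocompact.
split.
  split; first exact: (subspace_ideal L_approx E_fin L_cover XI IX).
  move=> a x; rewrite !memv_ker => /eqP x0'.
  by rewrite !model_hom_alg x0' amul0l amul0r eqxx.
split; first exact: (subspace_lker L_discrete E_fin IX).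
split; first by split; [exact: model_hom_alg|].
split; last exact: lker_integer_points.
move=> W0 W0n _ W0c; exact: (model_set_commensurable E_fin L_cover XI IX).
Qed.
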